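(* For all binary strings $x,y$, $$-\log \mathbf{e}(x,y)=\max(\mathrm{KP}(x\mid y),\mathrm{KP}(y\mid x))+O(1),$$ where the $O(1)$ term is bounded by a constant independent of $x,y$.
   Context: A computable partial function $U(p,x)$ of two binary-string arguments is prefix-free if for every $x$ the set of $p$ with $U(p,x)$ defined contains no string together with a proper prefix of it. For an infinite binary sequence $\pi$, write $U(\pi,x)=y$ if $U(p,x)=y$ for some finite prefix $p$ of $\pi$. Define $e_U(x,y)=\Pr_\pi[U(\pi,x)=y \text{ and } U(\pi,y)=x]$, where $\pi$ is a uniformly random infinite binary sequence (the prefixes used for the two computations may differ). There is a prefix-free $U$ making $e_U$ maximal up to a constant factor among all prefix-free computable partial functions; $\mathbf{e}$ denotes $e_U$ for such an optimal $U$. $\mathrm{KP}(y\mid x)$ is conditional prefix complexity: $\min\{|p|: V(p,x)=y\}$ for an optimal prefix-free computable partial $V$. Logarithms are base 2. *)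

(* Defs.v *)
From HB Require Import structures.
From mathcomp Require Import all_boot all_order all_algebra.
From mathcomp Require Import all_classical all_reals all_analysis.
Set Implicit Arguments. Unset Strict Implicit. Unset Printing Implicit Defensive.
Import Order.TTheory GRing.Theory Num.Theory.
Local Open Scope classical_set_scope.
Local Open Scope ring_scope.

Inductive code : Type :=
| CZero : code
| CSucc : code
| CProj : nat -> code
| CComp : code -> list code -> code
| CPrec : code -> code -> code
| CMu   : code -> code.

Inductive eval : code -> list nat -> nat -> Prop :=
| eval_zero args : eval CZero args 0
| eval_succ args : eval CSucc args (nth 0 args 0).+1
| eval_proj i args : eval (CProj i) args (nth 0 args i)
| eval_comp f gs args vs v :
    evals gs args vs -> eval f vs v -> eval (CComp f gs) args v
| eval_prec0 f g rest v :
    eval f rest v -> eval (CPrec f g) (0 :: rest) v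
| eval_precS f g n rest w v :
    eval (CPrec f g) (n :: rest) w -> eval g (n :: w :: rest) v ->
    eval (CPrec f g) (n.+1 :: rest) v
| eval_mu f args n :
    eval f (n :: args) 0 ->
    (forall m, (m < n)%N -> exists k, eval f (m :: args) k.+1) ->
    eval (CMu f) args n
with evals : list code -> list nat -> list nat -> Prop :=
| evals_nil args : evals nil args nil
| evals_cons g gs args v vs :
    eval g args v -> evals gs args vs -> evals (g :: gs) args (v :: vs).

(* Bijective encoding of binary strings as natural numbers. *)
Fixpoint enc (s : seq bool) : nat :=
  match s with
  | [::] => 0
  | b :: s' => ((enc s').*2 + (if b then 2 else 1))%N
  end.

Definition bstr := seq bool.

Definition pfun2 := bstr -> bstr -> option bstr.

Definition computable2 (U : pfun2) : Prop :=
  exists c : code, forall p x y : bstr,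
    U p x = Some y <-> eval c [:: enc p; enc x] (enc y).

Definition prefix_free (U : pfun2) : Prop :=
  forall x p q : bstr, U p x <> None -> U q x <> None -> prefix p q -> p = q.

Definition pf_computable (U : pfun2) : Prop := computable2 U /\ prefix_free U.

(* e_U(x,y) = Pr_pi[U(pi,x)=y and U(pi,y)=x].  The event is an open    *)
(* subset of Cantor space; its uniform measure is the supremum over n  *)
(* of the fraction of length-n strings s such that some prefix of s    *)
(* computes y from x and some (possibly different) prefix of s         *)
(* computes x from y.                                                  *)
Definition outputs_on (U : pfun2) (s x y : bstr) : bool :=
  [exists i : 'I_(size s).+1, U (take i s) x == Some y].

Definition e_approx {R : realType} (U : pfun2) (x y : bstr) (n : nat) : R :=
  (#|[set s : n.-tuple bool | outputs_on U (tval s) x y && outputs_on U (tval s) y x]|)%:R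
    / (2%:R ^+ n).

Definition eU {R : realType} (U : pfun2) (x y : bstr) : R :=
  sup (range (@e_approx R U x y)).

Definition e_optimal {R : realType} (U : pfun2) : Prop :=
  pf_computable U /\
  forall U' : pfun2, pf_computable U' ->
    exists c : R, 0 < c /\ forall x y, @eU R U' x y <= c * @eU R U x y.

Definition KPV {R : realType} (V : pfun2) (y x : bstr) : \bar R :=
  ereal_inf [set ((size p)%:R)%:E | p in [set p : bstr | V p x = Some y]].

Definition KP_optimal {R : realType} (V : pfun2) : Prop :=
  pf_computable V /\
  forall V' : pfun2, pf_computable V' ->
    exists c : R, forall x y, (@KPV R V y x <= @KPV R V' y x + c%:E)%E.

Definition log2 {R : realType} (r : R) : R := ln r / ln 2.

(* Main.v *)
Require Import Defs.
From HB Require Import structures.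
From mathcomp Require Import all_boot all_order all_algebra.
From mathcomp Require Import all_classical all_reals all_analysis.
From mathcomp Require Import zify lra.
Import Order.TTheory GRing.Theory Num.Theory.
Local Open Scope ring_scope.

(* Fix a prefix-free W and let m(y|x) be the sum of 2^-|p| over W p x = y.
   By Kraft's inequality the pairs (y, n) with m(y|x) >= 2^-n have total weight
   sum 2^-n <= 2 for each x, and the set of these triples (x, y, n) is enumerable.

   max KP <= -log e + O(1): e_U(x, y) <= m(y|x) for W = U, and reserving consecutive
   intervals of length 2^-(n+1) for the enumerated pairs (y, n) gives a prefix-free
   machine with a program of length n + 2 for y given x.

   -log e <= max KP + O(1): enumerate the triples (x, y, n) with both m(y|x) and m(x|y) at
   least 2^-n for W = V, and give the r-th triple its own block of n + 4 bits of
   pi, the blocks being consecutive. On input x the new machine reads pi block by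
   block and stops at the first zero block whose triple involves x, returning the
   other member. Blocks are independent, and the triples involving x or y have
   total weight at most 8, so with conditional probability at least 1 - 8/16 no
   earlier such block is zero, and both computations stop at the block of (x, y, n). *)

Set Implicit Arguments.
Unset Strict Implicit.

Local Notation code := Defs.code.
Local Notation eval := Defs.eval.

Local Open Scope nat_scope.

(** * Computable functions *)

(** The automatic induction principle gives no hypothesis for the codes inside the list of [CComp];
    the nested fixpoint supplies it. *)
Lemma code_list_ind (P : code -> Prop) :
  P CZero -> P CSucc -> (forall i, P (CProj i)) ->
  (forall f gs, P f -> List.Forall P gs -> P (CComp f gs)) ->
  (forall f g, P f -> P g -> P (CPrec f g)) ->
  (forall f, P f -> P (CMu f)) -> forall c, P c.
Proof.
move=> Pz Ps Pp Pc Pr Pm; fix IH 1; case=> [| |i|f gs|f g|f].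
- exact: Pz.
- exact: Ps.
- exact: Pp.
- apply: Pc; first exact: IH.
  by elim: gs => [|g gs IHgs]; constructor; [exact: IH|exact: IHgs].
- by apply: Pr; exact: IH.
- by apply: Pm; exact: IH.
Qed.

(** Induction on the code. For [CMu], if two results differed, [f] would return both zero and a
    successor at the smaller one. *)
Lemma eval_inj c args v w : eval c args v -> eval c args w -> v = w.
Proof.
elim/code_list_ind: c args v w => [||i|f gs IHf IHgs|f g IHf IHg|f IHf] args v w.
- by move=> Hv Hw; inversion Hv; inversion Hw.
- by move=> Hv Hw; inversion Hv; inversion Hw.
- by move=> Hv Hw; inversion Hv; inversion Hw.
- move=> Hv Hw; inversion Hv as [| | |f1 gs1 a1 vs1 v1 G1 F1| | |]; subst.
  inversion Hw as [| | |f2 gs2 a2 vs2 v2 G2 F2| | |]; subst.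
  suff vsE : vs1 = vs2 by subst; exact: IHf F1 F2.
  elim: gs IHgs vs1 vs2 G1 G2 {Hv Hw F1 F2} => [|g gs IH] IHgs vs1 vs2 G1 G2.
    by inversion G1; inversion G2.
  inversion IHgs as [|? ? Pg Pgs]; subst.
  inversion G1 as [|? ? ? u us Hu Hus]; inversion G2 as [|? ? ? u' us' Hu' Hus']; subst.
  by rewrite (Pg _ _ _ Hu Hu') (IH Pgs _ _ Hus Hus').
- case: args => [|n rest]; first by move=> Hv; inversion Hv.
  elim: n v w => [|n IHn] v w Hv Hw; inversion Hv; inversion Hw; subst.
    by eauto.
  match goal with H1 : eval (CPrec f g) (n :: rest) ?a,
                  H2 : eval (CPrec f g) (n :: rest) ?b |- _ =>
    have E := IHn _ _ H1 H2 end.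
  by subst; eauto.
- move=> Hv Hw; inversion Hv as [| | | | | |f1 a1 n1 V0 V1]; subst.
  inversion Hw as [| | | | | |f2 a2 n2 W0 W1]; subst.
  case: (ltngtP v w) => // lt.
    by have [k Hk] := W1 _ lt; have := IHf _ _ _ V0 Hk.
  by have [k Hk] := V1 _ lt; have := IHf _ _ _ W0 Hk.
Qed.

Definition computable (k : nat) (f : seq nat -> nat) :=
  exists c, forall v, size v = k -> eval c v (f v).

Lemma computable_ext k f g : (forall v, size v = k -> f v = g v) -> computable k f -> computable k g.
Proof. by move=> E [c Hc]; exists c => v sv; rewrite -E //; exact: Hc. Qed.

Lemma computable_succ k f : computable k f -> computable k (fun v => (f v).+1).
Proof.
move=> [c Hc]; exists (CComp CSucc [:: c]) => v sv.
apply: (@eval_comp _ _ _ [:: f v]); last exact: (eval_succ [:: f v]).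
by apply: evals_cons; [exact: Hc|exact: evals_nil].
Qed.

Lemma computable_const k n : computable k (fun=> n).
Proof.
elim: n => [|n IH]; last exact: computable_succ.
by exists CZero => v _; exact: eval_zero.
Qed.

Lemma nth_iter_behead m j (v : seq nat) : nth 0 (iter m behead v) j = nth 0 v (m + j).
Proof. by elim: m j => //= m IH j; rewrite nth_behead IH addnS. Qed.

Lemma computable_var k m j : computable k (fun v => nth 0 (iter m behead v) j).
Proof.
exists (CProj (m + j)) => v _.
by rewrite nth_iter_behead; exact: eval_proj.
Qed.

Lemma computable_comp k (fs : seq (seq nat -> nat)) g :
  computable (size fs) g -> List.Forall (computable k) fs ->
  computable k (fun v => g [seq f v | f <- fs]).
Proof.
move=> [c Hc] Hfs.
have [cs Hcs] : exists cs, forall v, size v = k -> evals cs v [seq f v | f <- fs].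
  elim: Hfs => [|f l [d Hd] _ [ds Hds]].
    by exists [::] => v _; exact: evals_nil.
  by exists (d :: ds) => v sv; apply: evals_cons; [exact: Hd|exact: Hds].
exists (CComp c cs) => v sv; apply: eval_comp (Hcs v sv) _.
by apply: Hc; rewrite size_map.
Qed.

(** Handles bound variables: a binder extends the argument list at its head, so a function known to
    be computable in one context is reused in another by replacing the first [m] entries with
    computed values. *)
Lemma computable_subst k m (fs : seq (seq nat -> nat)) g :
  computable (size fs + k) g -> List.Forall (computable (m + k)) fs ->
  computable (m + k) (fun v => g ([seq f v | f <- fs] ++ iter m behead v)).
Proof.
move=> Hg Hfs.
pose ps := [seq (fun v => nth 0 v i) | i <- iota m k].
apply: (@computable_ext _ (fun v => g [seq f v | f <- fs ++ ps])).
  move=> v sv; rewrite map_cat -map_comp; congr (g (_ ++ _)).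
  have sm : size (iter m behead v) = k.
    suff -> : size (iter m behead v) = size v - m by rewrite sv addKn.
    by elim: m {Hfs ps sv} => [|m /= IH]; rewrite ?subn0 // size_behead IH subnS.
  apply: (@eq_from_nth _ 0); rewrite size_map size_iota // => i ik.
  by rewrite (nth_map 0) ?size_iota //= nth_iota // nth_iter_behead.
apply: computable_comp; first by rewrite size_cat size_map size_iota.
apply/List.Forall_app; split=> //; rewrite /ps.
elim: (iota m k) => [|i l IH]; constructor => //.
exact: (computable_var _ 0 i).
Qed.

(** The step reads the counter and the previous value as entries 0 and 1, the order in which
    [eval_precS] passes them. *)
Lemma computable_rec k (f n : seq nat -> nat) (g : seq nat -> nat -> nat -> nat) :
  computable k f -> computable k.+2 (fun v => g (behead (behead v)) (nth 0 v 0) (nth 0 v 1)) ->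
  computable k n -> computable k (fun v => nat_rect (fun=> nat) (f v) (g v) (n v)).
Proof.
move=> [cf Hf] [cg Hg] Hn.
apply: (@computable_subst k 0 [:: n] (fun u => nat_rect (fun=> nat) (f (behead u))
  (g (behead u)) (nth 0 u 0))); last by constructor.
exists (CPrec cf cg) => -[|m v] //= [sv].
elim: m => [|m IH] /=; first by apply: eval_prec0; apply: Hf.
by apply: eval_precS IH _; apply: (Hg [:: m, _ & v]) => /=; rewrite sv.
Qed.

Lemma computable_comp1 k (g : nat -> nat) f :
  computable 1 (fun v => g (nth 0 v 0)) -> computable k f -> computable k (fun v => g (f v)).
Proof. by move=> Hg Hf; apply: (@computable_comp k [:: f] _ Hg); constructor. Qed.

Lemma computable_comp2 k (g : nat -> nat -> nat) f1 f2 :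
  computable 2 (fun v => g (nth 0 v 0) (nth 0 v 1)) -> computable k f1 -> computable k f2 ->
  computable k (fun v => g (f1 v) (f2 v)).
Proof. by move=> Hg H1 H2; apply: (@computable_comp k [:: f1; f2] _ Hg); do !constructor. Qed.

Lemma computable_comp4 k (g : nat -> nat -> nat -> nat -> nat) f1 f2 f3 f4 :
  computable 4 (fun v => g (nth 0 v 0) (nth 0 v 1) (nth 0 v 2) (nth 0 v 3)) ->
  computable k f1 -> computable k f2 -> computable k f3 -> computable k f4 ->
  computable k (fun v => g (f1 v) (f2 v) (f3 v) (f4 v)).
Proof.
by move=> Hg H1 H2 H3 H4; apply: (@computable_comp k [:: f1; f2; f3; f4] _ Hg); do !constructor.
Qed.

Lemma computable_behead k g : computable k g -> computable k.+1 (fun v => g (behead v)).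
Proof. by move=> Hg; apply: (@computable_subst k 1 [::]). Qed.

Lemma computable_skip k g :
  computable k.+1 g -> computable k.+2 (fun v => g (nth 0 v 0 :: behead (behead v))).
Proof.
move=> Hg; apply: (@computable_subst k 2 [:: fun v => nth 0 v 0]) => //.
by constructor => //; exact: (computable_var _ 0 0).
Qed.

Lemma computable_add k f g : computable k f -> computable k g -> computable k (fun v => f v + g v).
Proof.
move=> Hf Hg; apply: (@computable_ext _ (fun v => nat_rect (fun=> nat) (g v) (fun _ w => w.+1) (f v))).
  by move=> v _; elim: (f v) => //= n ->.
by apply: computable_rec => //; apply: computable_succ; exact: (computable_var _ 0 1).
Qed.

Lemma computable_sum k (g : seq nat -> nat -> nat) n :
  computable k.+1 (fun v => g (behead v) (nth 0 v 0)) -> computable k n ->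
  computable k (fun v => \sum_(0 <= i < n v) g v i).
Proof.
move=> Hg Hn.
apply: (@computable_ext _ (fun v => nat_rect (fun=> nat) 0 (fun i w => w + g v i) (n v))).
  by move=> v _; elim: (n v) => [|m IH] /=; [rewrite big_geq|rewrite big_nat_recr //= IH].
apply: computable_rec => //; first exact: computable_const.
apply: computable_add; first exact: (computable_var _ 0 1).
exact: (computable_skip Hg).
Qed.

Lemma computable_mul k f g : computable k f -> computable k g -> computable k (fun v => f v * g v).
Proof.
move=> Hf Hg; apply: (@computable_ext _ (fun v => \sum_(0 <= i < f v) g v)).
  by move=> v _; rewrite sum_nat_const_nat subn0.
apply: (@computable_sum _ (fun v _ => g v)) => //.
exact: computable_behead.
Qed.

Lemma computable_predn k f : computable k f -> computable k (fun v => (f v).-1).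
Proof.
move=> Hf; apply: (@computable_ext _ (fun v => nat_rect (fun=> nat) 0 (fun i _ => i) (f v))).
  by move=> v _; case: (f v).
by apply: computable_rec => //; [exact: computable_const|exact: (computable_var _ 0 0)].
Qed.

Lemma computable_sub k f g : computable k f -> computable k g -> computable k (fun v => f v - g v).
Proof.
move=> Hf Hg; apply: (@computable_ext _ (fun v => nat_rect (fun=> nat) (f v) (fun _ w => w.-1) (g v))).
  by move=> v _; elim: (g v) => [|n /= ->]; rewrite ?subn0 // subnS.
by apply: computable_rec => //; apply: computable_predn; exact: (computable_var _ 0 1).
Qed.

Lemma computable_expn k f g : computable k f -> computable k g -> computable k (fun v => f v ^ g v).
Proof.
move=> Hf Hg; apply: (@computable_ext _ (fun v => nat_rect (fun=> nat) 1 (fun _ w => f v * w) (g v))).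
  by move=> v _; elim: (g v) => //= n ->; rewrite expnS.
apply: (@computable_rec _ _ _ (fun v _ w => f v * w)) => //; first exact: computable_const.
apply: computable_mul; last exact: (computable_var _ 0 1).
by apply: (@computable_behead _ (fun v => f (behead v))); exact: computable_behead.
Qed.

Lemma computable_neg k (b : seq nat -> bool) :
  computable k (fun v => b v) -> computable k (fun v => ~~ b v).
Proof.
move=> Hb; apply: (@computable_ext _ (fun v => 1 - b v)); first by move=> v _; case: (b v).
by apply: computable_sub => //; exact: computable_const.
Qed.

Lemma computable_and k (b c : seq nat -> bool) :
  computable k (fun v => b v) -> computable k (fun v => c v) -> computable k (fun v => b v && c v).
Proof.
move=> Hb Hc; apply: (@computable_ext _ (fun v => b v * c v)); last exact: computable_mul.
by move=> v _; case: (b v); case: (c v).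
Qed.

Lemma computable_or k (b c : seq nat -> bool) :
  computable k (fun v => b v) -> computable k (fun v => c v) -> computable k (fun v => b v || c v).
Proof.
move=> Hb Hc; apply: (@computable_ext _ (fun v => ~~ (~~ b v && ~~ c v))).
  by move=> v _; case: (b v); case: (c v).
by apply: (@computable_neg _ (fun v => ~~ b v && ~~ c v)); apply: computable_and; exact: computable_neg.
Qed.

Lemma computable_leq k f g : computable k f -> computable k g -> computable k (fun v => f v <= g v).
Proof.
move=> Hf Hg; apply: (@computable_ext _ (fun v => 1 - (f v - g v))).
  by move=> v _; rewrite -subn_eq0; case: (f v - g v).
by apply: computable_sub; [exact: computable_const|exact: computable_sub].
Qed.

Lemma computable_eq k f g : computable k f -> computable k g -> computable k (fun v => f v == g v).
Proof.
move=> Hf Hg; apply: (@computable_ext _ (fun v => (f v <= g v) && (g v <= f v))).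
  by move=> v _; rewrite eqn_leq.
by apply: computable_and; exact: computable_leq.
Qed.

Lemma computable_if k (b : seq nat -> bool) f g :
  computable k (fun v => b v) -> computable k f -> computable k g ->
  computable k (fun v => if b v then f v else g v).
Proof.
move=> Hb Hf Hg; apply: (@computable_ext _ (fun v => b v * f v + (~~ b v) * g v)).
  by move=> v _; case: (b v); rewrite /= ?mul1n ?mul0n ?addn0.
by apply: computable_add; apply: computable_mul => //; exact: computable_neg.
Qed.

Lemma sum_ltn m q : \sum_(0 <= i < m) (i < q) = minn m q.
Proof. by elim: m => [|m IH]; [rewrite big_geq ?min0n|rewrite big_nat_recr //= IH; lia]. Qed.

(** Turns division into a bounded sum, hence into something [computable_sum] covers. *)
Lemma divn_sum m d : 0 < d -> m %/ d = \sum_(0 <= i < m) (i.+1 * d <= m).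
Proof.
move=> d0; rewrite -[LHS](minn_idPr (leq_div m d)) -sum_ltn.
by apply: eq_big_nat => i _; rewrite leq_divRL.
Qed.

Lemma computable_div2 k f g : computable k f -> computable k g -> computable k (fun v => f v %/ 2 ^ g v).
Proof.
move=> Hf Hg; apply: (@computable_ext _ (fun v => \sum_(0 <= i < f v) (i.+1 * 2 ^ g v <= f v))).
  by move=> v _; rewrite divn_sum // expn_gt0.
apply: (@computable_sum _ (fun v i => (i.+1 * 2 ^ g v <= f v))) => //.
apply: computable_leq; last exact: computable_behead.
apply: computable_mul; first by apply: computable_succ; exact: (computable_var _ 0 0).
by apply: computable_expn; [exact: computable_const|exact: (@computable_behead _ g)].
Qed.

Lemma computable_dvd2 k f g : computable k f -> computable k g -> computable k (fun v => 2 ^ g v %| f v).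
Proof.
move=> Hf Hg; apply: (@computable_ext _ (fun v => f v %/ 2 ^ g v * 2 ^ g v == f v)).
  by move=> v _; rewrite dvdn_eq.
apply: computable_eq => //; apply: computable_mul; first exact: computable_div2.
by apply: computable_expn => //; exact: computable_const.
Qed.

Lemma computable_odd k f : computable k f -> computable k (fun v => odd (f v)).
Proof.
move=> Hf; apply: (@computable_ext _ (fun v => ~~ (2 ^ 1 %| f v))).
  by move=> v _; rewrite dvdn2 negbK.
by apply: computable_neg; apply: computable_dvd2 => //; exact: computable_const.
Qed.

Lemma computable_logn k f : computable k f -> computable k (fun v => logn 2 (f v).+1).
Proof.
move=> Hf; apply: (@computable_ext _ (fun v => \sum_(0 <= i < f v) (2 ^ i.+1 %| (f v).+1))).
  by move=> v _; rewrite logn_count_dvd // big_add1.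
apply: (@computable_sum _ (fun v i => 2 ^ i.+1 %| (f v).+1)) => //.
apply: computable_dvd2; first by apply: computable_succ; exact: computable_behead.
by apply: computable_succ; exact: (computable_var _ 0 0).
Qed.

Ltac computable_step :=
  lazymatch goal with
  | |- computable _ (fun v => nat_of_bool (_ <= _)) => apply: computable_leq
  | |- computable _ (fun v => nat_of_bool (_ == _ :> nat)) => apply: computable_eq
  | |- computable _ (fun v => nat_of_bool (~~ _)) => apply: computable_neg
  | |- computable _ (fun v => nat_of_bool (_ && _)) => apply: computable_and
  | |- computable _ (fun v => nat_of_bool (_ || _)) => apply: computable_or
  | |- computable _ (fun v => nat_of_bool (2 ^ _ %| _)) => apply: computable_dvd2
  | |- computable _ (fun v => nat_of_bool (odd _)) => apply: computable_odd
  | |- computable _ (fun v => \sum_(0 <= i < _) _) => refine (@computable_sum _ (fun v i => _) _ _ _)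
  | |- computable _ (fun v => _ %/ 2 ^ _) => apply: computable_div2
  | |- computable _ (fun v => logn 2 _.+1) => apply: computable_logn
  | |- computable _ (fun v => _ + _) => apply: computable_add
  | |- computable _ (fun v => _ - _) => apply: computable_sub
  | |- computable _ (fun v => _ * _) => apply: computable_mul
  | |- computable _ (fun v => _ ^ _) => apply: computable_expn
  | |- computable _ (fun v => _.+1) => apply: computable_succ
  | |- computable _ (fun v => _.-1) => apply: computable_predn
  | |- computable _ (fun v => if _ then _ else _) => apply: computable_if
  | |- computable _ (fun v => nth 0 v ?j) => exact: (computable_var _ 0 j)
  | |- computable _ (fun v => nth 0 (behead v) ?j) => exact: (computable_var _ 1 j)
  | |- computable _ (fun v => nth 0 (behead (behead v)) ?j) => exact: (computable_var _ 2 j)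
  | |- computable _ (fun v => nth 0 (behead (behead (behead v))) ?j) => exact: (computable_var _ 3 j)
  | |- computable _ (fun _ => ?n) => exact: computable_const
  end.
Ltac computable_auto := repeat (cbv beta; computable_step).

(** * Stage-by-stage simulation *)

(* [F t args] is [v.+1] if [c] is seen at stage [t] to output [v] on [args], and
   [0] if nothing is known yet. *)
Definition stepwise c k (F : nat -> seq nat -> nat) :=
  [/\ computable k.+1 (fun v => F (nth 0 v 0) (behead v)),
      forall t args v, size args = k -> F t args = v.+1 -> eval c args v &
      forall args v, size args = k -> eval c args v ->
        exists t0, forall t, t0 <= t -> F t args = v.+1].

Lemma stepwise_total c k f :
  computable k f -> (forall args, eval c args (f args)) ->
  exists F, stepwise c k F.
Proof.
move=> Hf Ec; exists (fun _ args => (f args).+1); split.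
- by apply: computable_succ; exact: computable_behead.
- by move=> _ args v _ [<-].
- by move=> args v _ Ev; exists 0 => t _; rewrite (eval_inj Ev (Ec args)).
Qed.

Lemma stepwise_list k gs :
  List.Forall (fun g => exists F, stepwise g k F) gs ->
  exists Fs : seq (nat -> seq nat -> nat),
    [/\ size Fs = size gs,
        List.Forall (fun F => computable k.+1 (fun v => F (nth 0 v 0) (behead v))) Fs,
        forall t args vs, size args = k -> [seq F t args | F <- Fs] = map succn vs ->
          evals gs args vs &
        forall args vs, size args = k -> evals gs args vs ->
          exists t0, forall t, t0 <= t -> [seq F t args | F <- Fs] = map succn vs].
Proof.
elim=> [|g {}gs [F [cF sF eF]] _ [Fs [szFs cFs sFs eFs]]].
  exists [::]; split => // [t args [|//] _ _|args vs _ Evs]; first exact: evals_nil.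
  by exists 0; inversion Evs.
exists (F :: Fs); split => [||t args [|v vs] //= sa [Ev Evs]|args vs sa Evs].
- by rewrite /= szFs.
- by constructor.
- by apply: evals_cons; [exact: sF Ev|exact: sFs Evs].
- inversion Evs as [|? ? ? v vs' Ev Evs']; subst.
  have [t1 H1] := eF _ _ (erefl _) Ev; have [t2 H2] := eFs _ _ (erefl _) Evs'.
  exists (maxn t1 t2) => t; rewrite geq_max => /andP[l1 l2] /=.
  by rewrite H1 // H2.
Qed.

Lemma computable_all k (Fs : seq (nat -> seq nat -> nat)) :
  List.Forall (fun F => computable k.+1 (fun v => F (nth 0 v 0) (behead v))) Fs ->
  computable k.+1 (fun v => all (fun F => 0 < F (nth 0 v 0) (behead v)) Fs).
Proof.
elim=> [|F {}Fs cF _ IH] /=; first exact: computable_const.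
apply: (@computable_and _ (fun v => 0 < F _ _)) => //.
by apply: computable_leq => //; exact: computable_const.
Qed.

Lemma evals_size gs args vs : evals gs args vs -> size vs = size gs.
Proof.
elim: gs vs => [|g gs IH] vs E; inversion E; subst => //=.
by congr S; exact: IH.
Qed.

Lemma stepwise_comp f gs k :
  (exists F, stepwise f (size gs) F) ->
  List.Forall (fun g => exists F, stepwise g k F) gs ->
  exists F, stepwise (CComp f gs) k F.
Proof.
move=> [F [cF sF eF]] /stepwise_list[Fs [szFs cFs sFs eFs]].
(* The guard is essential: without it an unknown inner value, coded 0, would be read by [.-1] as the
   output 0. *)
exists (fun t args => if all (fun G => 0 < G t args) Fs
                      then F t [seq (G t args).-1 | G <- Fs] else 0); split.
- apply: computable_if; [exact: computable_all| |exact: computable_const].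
  pose Gs := (fun v => nth 0 v 0) ::
    [seq (fun v => (G (nth 0 v 0) (behead v)).-1) | G <- Fs].
  apply: (@computable_ext _ (fun v => (fun u => F (nth 0 u 0) (behead u)) [seq f v | f <- Gs])).
    by move=> v _; rewrite /= -map_comp.
  apply: (@computable_comp _ Gs (fun u => F (nth 0 u 0) (behead u))).
    by rewrite /= size_map szFs.
  constructor; first exact: (computable_var _ 0 0).
  by elim: cFs => [|G l cG _ IH]; constructor => //; exact: computable_predn.
- move=> t args v sa; case: ifP => // pos Ev.
  apply: (@eval_comp _ _ _ [seq (G t args).-1 | G <- Fs]); last first.
    by apply: sF Ev; rewrite size_map szFs.
  apply: (sFs t) => //; rewrite -map_comp.
  elim: Fs pos {szFs cFs sFs eFs Ev} => //= G l IH /andP[G0 /IH ->].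
  by rewrite prednK.
- move=> args v sa Ev; inversion Ev as [| | |f1 gs1 a1 vs v1 Evs Evf| | |]; subst.
  have [t1 H1] := eFs _ _ (erefl _) Evs; have [t2 H2] := eF _ _ (evals_size Evs) Evf.
  exists (maxn t1 t2) => t; rewrite geq_max => /andP[/H1 e1 /H2 e2].
  suff [-> ->] : all (fun G => 0 < G t args) Fs /\ [seq (G t args).-1 | G <- Fs] = vs by [].
  elim: Fs vs e1 {szFs cFs sFs eFs Evs Evf H1 e2 H2} => [|G l IH] [|u us] //= [-> /IH[-> ->]].
  by [].
Qed.

Lemma stepwise_prec f g k :
  (exists F, stepwise f k F) -> (exists F, stepwise g k.+2 F) ->
  exists F, stepwise (CPrec f g) k.+1 F.
Proof.
move=> [F [cF sF eF]] [G [cG sG eG]].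
(* The value 0 is absorbing: while one level of the recursion is unknown, so are all later ones. A
   known [w] stands for the output [w.-1]. *)
pose H t rest := nat_rect (fun=> nat) (F t rest)
   (fun i w => if w == 0 then 0 else G t [:: i, w.-1 & rest]).
exists (fun t args => H t (behead args) (nth 0 args 0)); split.
- apply: (@computable_rec _ _ _ (fun v i w => if w == 0 then 0
    else G (nth 0 v 0) [:: i, w.-1 & behead (behead v)])).
  + apply: (@computable_subst k 2 [:: fun v => nth 0 v 0] _ cF).
    by constructor => //; exact: (computable_var _ 0 0).
  + apply: computable_if; [computable_auto|computable_auto|].
    apply: (@computable_subst k 4 [:: fun v => nth 0 (behead (behead v)) 0;
      fun v => nth 0 v 0; fun v => (nth 0 v 1).-1] _ cG).
    by do !constructor; computable_auto.
  + exact: (computable_var _ 1 0).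
- move=> t [|n rest] //= v [sr].
  elim: n v => [|n IH] v /=; first by move/(sF _ _ _ sr) => Ev; exact: eval_prec0.
  case E : (H t rest n) => [|w] //= /sG Ev.
  by apply: eval_precS (IH _ E) (Ev _); rewrite /= sr.
- move=> [|n rest] //= v [sr].
  elim: n v => [|n IH] v Ev; inversion Ev; subst.
    by apply: eF.
  match goal with H1 : eval (CPrec f g) _ ?w, H2 : eval g _ _ |- _ =>
    have [t1 E1] := IH _ H1; have [|t2 E2] := eG [:: n, w & rest] v _ H2 end.
    by [].
  exists (maxn t1 t2) => t; rewrite geq_max => /andP[/E1 e1 /E2 e2].
  by rewrite /= e1 /= e2.
Qed.

Lemma uniform_bound (P : nat -> nat -> Prop) n :
  (forall m, m < n -> exists t0, forall t, t0 <= t -> P m t) ->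
  exists t0, forall t, t0 <= t -> forall m, m < n -> P m t.
Proof.
elim: n => [|n IH] Hn; first by exists 0.
have [m ltmn|t1 H1] := IH; first by apply: Hn; exact: ltnW.
have [t2 H2] := Hn n (leqnn _).
exists (maxn t1 t2) => t; rewrite geq_max => /andP[/H1 e1 /H2 e2] m.
by rewrite ltnS leq_eqVlt => /orP[/eqP->|/e1].
Qed.

Lemma sum_eq0P n (f : nat -> nat) :
  reflect (forall i, i < n -> f i = 0) (\sum_(0 <= i < n) f i == 0).
Proof.
rewrite big_mkord sum_nat_eq0; apply: (iffP forallP) => [H i ltin|H i].
  by apply/eqP; exact: (H (Ordinal ltin)).
by rewrite H.
Qed.

Lemma sum_single n (f : nat -> nat) j :
  j < n -> (forall i, i < n -> i != j -> f i = 0) -> \sum_(0 <= i < n) f i = f j.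
Proof.
move=> ltjn f0; rewrite big_mkord (bigD1 (Ordinal ltjn)) //= big1 ?addn0 // => i.
by rewrite -val_eqE /= => ij; exact: f0.
Qed.

Lemma stepwise_mu f k :
  (exists F, stepwise f k.+1 F) -> exists F, stepwise (CMu f) k F.
Proof.
move=> [F [cF sF eF]].
(* The test [== 1] means that output 0 is seen at [n]; a value below 2 at some [m < n] would mean
   unknown or output 0, so all earlier outputs are required to be known and nonzero. *)
pose first t args n := (F t (n :: args) == 1)
  && (\sum_(0 <= m < n) (F t (m :: args) < 2) == 0).
have firstP t args n m : first t args n -> first t args m -> n = m.
  move=> /andP[/eqP Fn /sum_eq0P Ln] /andP[/eqP Fm /sum_eq0P Lm].
  by case: (ltngtP n m) => // [/Lm|/Ln]; rewrite ?Fn ?Fm.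
(* At most one [n] satisfies [first], so the sum has at most one nonzero term, which is the coded
   answer [n.+1]. *)
exists (fun t args => \sum_(0 <= n < t) (if first t args n then n.+1 else 0)); split.
- refine (@computable_sum _ (fun v i => _) _ _ _); last exact: (computable_var _ 0 0).
  apply: computable_if; [apply: computable_and| |]; [| |computable_auto|computable_auto].
    apply: computable_eq; last exact: computable_const.
    apply: (@computable_subst k 2 [:: fun v => nth 0 (behead v) 0; fun v => nth 0 v 0] _ cF).
    by do !constructor; computable_auto.
  apply: computable_eq; last exact: computable_const.
  refine (@computable_sum _ (fun v i => _) _ _ _); last exact: (computable_var _ 0 0).
  apply: computable_leq; last exact: computable_const.
  apply: computable_succ.
  apply: (@computable_subst k 3 [:: fun v => nth 0 (behead (behead v)) 0; fun v => nth 0 v 0] _ cF).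
  by do !constructor; computable_auto.
- move=> t args v sa.
  case: (pselect (exists2 n, n < t & first t args n)) => [[n ltnt Fn]|none]; last first.
    rewrite (_ : \sum_(0 <= n < t) _ = 0) //; apply/eqP/sum_eq0P => i ltit.
    by case: ifP => // Fi; case: none; exists i.
  rewrite (@sum_single _ _ n) // ?Fn => [[<-]|i _ ni]; last first.
    by case: ifP => // Fi; rewrite (firstP _ _ _ _ Fi Fn) eqxx in ni.
  case/andP: Fn => /eqP Fn /sum_eq0P Ln; apply: eval_mu.
    by apply: sF Fn; rewrite /= sa.
  move=> m /Ln; case E : (F t (m :: args)) => [|[|w]] // _.
  by exists w; apply: sF E; rewrite /= sa.
- move=> args n sa Ev; inversion Ev as [| | | | | |f1 a1 n1 V0 V1]; subst.
  have [|t1 H1] := eF _ _ _ V0; first by rewrite /=.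
  have [|t2 H2] := @uniform_bound (fun m t => 2 <= F t (m :: args)) n.
    move=> m /V1[w Ew]; have [|t0 H0] := eF _ _ _ Ew; first by rewrite /=.
    by exists t0 => t /H0 ->.
  exists (maxn n.+1 (maxn t1 t2)) => t; rewrite !geq_max => /and3P[ltnt /H1 e1 /H2 e2].
  have Fn : first t args n.
    by rewrite /first e1 eqxx; apply/sum_eq0P => m /e2; case: (F t (m :: args)) => [|[|w]].
  rewrite (@sum_single _ _ n) // ?Fn => // i _ ni.
  by case: ifP => // Fi; rewrite (firstP _ _ _ _ Fi Fn) eqxx in ni.
Qed.

Lemma stepwise_ex c k : exists F, stepwise c k F.
Proof.
elim/code_list_ind: c k => [||i|f gs IHf IHgs|f g IHf IHg|f IHf] k.
- by apply: (@stepwise_total _ _ (fun=> 0)); [exact: computable_const|exact: eval_zero].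
- apply: (@stepwise_total _ _ (fun v => (nth 0 v 0).+1)); last exact: eval_succ.
  by computable_auto.
- by apply: (@stepwise_total _ _ (fun v => nth 0 v i)); [computable_auto|exact: eval_proj].
- apply: stepwise_comp => //.
  by apply: List.Forall_impl IHgs => g; exact.
(* With no argument to recurse on, [CPrec] has no evaluation, so the simulation that never answers
   is correct. *)
- case: k => [|k]; last exact: stepwise_prec.
  exists (fun _ _ => 0); split => [|//|[|//] v _ Ev]; first exact: computable_const.
  by inversion Ev.
- exact: stepwise_mu.
Qed.

(** * Strings, numerals and search machines *)

Lemma enc_inj : injective enc.
Proof.
elim=> [|b s IH] [|c t] //=; first by case: c; lia.
  by case: b; lia.
by case: b; case: c => // E; congr cons; try apply: IH; lia.
Qed.

Lemma enc_surj n : exists s, enc s = n.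
Proof.
elim/ltn_ind: n => -[|n] IH; first by exists [::].
have [s Es] : exists s, enc s = n./2 by apply: IH; lia.
by exists (odd n :: s); rewrite /= Es; have := odd_double_half n; case: (odd n); lia.
Qed.

Definition dec n : bstr := sval (cid (enc_surj n)).

Lemma decK : cancel dec enc.
Proof. by move=> n; rewrite /dec; case: cid. Qed.

Lemma encK : cancel enc dec.
Proof. by move=> s; apply: enc_inj; rewrite decK. Qed.

(** The common shape of the machines below: an unbounded search for a number [r] that validates the
    program, followed by a total readout. *)
Definition search (P : nat -> nat -> nat -> bool) (out : nat -> nat -> nat -> nat) : pfun2 :=
  fun p x => match pselect (exists r, P r (enc p) (enc x)) with
             | left ex => Some (dec (out (ex_minn ex) (enc p) (enc x)))
             | right _ => None
             end.

(** Minimisation by [CMu] looks for a zero, so it is applied to the negation of [P]. *)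
Lemma search_computable (P : nat -> nat -> nat -> bool) out :
  computable 3 (fun v => P (nth 0 v 0) (nth 0 v 1) (nth 0 v 2)) ->
  computable 3 (fun v => out (nth 0 v 0) (nth 0 v 1) (nth 0 v 2)) ->
  computable2 (search P out).
Proof.
move=> /(@computable_neg _ (fun v => P _ _ _))[c Hc] [d Hd].
exists (CComp d [:: CMu c; CProj 0; CProj 1]) => p x y.
have cP r : eval c [:: r; enc p; enc x] (~~ P r (enc p) (enc x)) by exact: Hc.
have muP r : eval (CMu c) [:: enc p; enc x] r <->
    P r (enc p) (enc x) /\ forall m, m < r -> ~~ P m (enc p) (enc x).
  split=> [Er|[Pr Pm]].
    inversion Er as [| | | | | |f1 a1 n1 V0 V1]; subst; split.
      by have := eval_inj V0 (cP r); case: (P r _ _).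
    by move=> m /V1[k /eval_inj/(_ (cP m))]; case: (P m _ _).
  apply: eval_mu; first by have := cP r; rewrite Pr.
  by move=> m /Pm Nm; exists 0; have := cP m; rewrite Nm.
have outP r : eval (CMu c) [:: enc p; enc x] r ->
    eval (CComp d [:: CMu c; CProj 0; CProj 1]) [:: enc p; enc x] (out r (enc p) (enc x)).
  move=> Er; apply: (@eval_comp _ _ _ [:: r; enc p; enc x]); last exact: Hd.
  apply: evals_cons => //; apply: evals_cons; first exact: (eval_proj 0 [:: enc p; enc x]).
  by apply: evals_cons; [exact: (eval_proj 1 [:: enc p; enc x])|exact: evals_nil].
rewrite /search; case: pselect => [ex|none].
  case: ex_minnP => r Pr rmin.
  have Er : eval (CMu c) [:: enc p; enc x] r.
    by apply/muP; split=> // m; rewrite ltnNge; apply: contra => /rmin.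
  split=> [[<-]|Ey]; first by rewrite decK; exact: outP.
  by rewrite (eval_inj (outP _ Er) Ey) encK.
split=> // Ey; inversion Ey as [| | |f1 gs1 a1 vs1 v1 G1 F1| | |]; subst.
inversion G1 as [|? ? ? r ? Er _]; subst.
by case: none; exists r; case/muP: Er.
Qed.

Lemma search_Some P out p x y : search P out p x = Some y ->
  exists2 r, P r (enc p) (enc x) & enc y = out r (enc p) (enc x).
Proof.
rewrite /search; case: pselect => // ex; case: ex_minnP => r Pr _ [<-].
by exists r => //; rewrite decK.
Qed.

Lemma searchE (P : nat -> nat -> nat -> bool) out p x r : P r (enc p) (enc x) ->
  (forall m, P m (enc p) (enc x) -> m = r) ->
  search P out p x = Some (dec (out r (enc p) (enc x))).
Proof.
move=> Pr uniq_r; rewrite /search; case: pselect => [ex|[]]; last by exists r.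
by case: ex_minnP => m /uniq_r -> _.
Qed.

(** Collecting the answers of all stages before [t] makes the test monotone in [t], which [stepwise]
    alone does not guarantee. *)
Lemma halting_ex W : computable2 W -> exists h : nat -> nat -> nat -> nat -> bool,
  [/\ computable 4 (fun v => h (nth 0 v 0) (nth 0 v 1) (nth 0 v 2) (nth 0 v 3)),
      forall t t' p x y, t <= t' -> h t p x y -> h t' p x y &
      forall p x y, W p x = Some y <-> exists t, h t (enc p) (enc x) (enc y)].
Proof.
move=> [c Hc]; have [F [cF sF eF]] := stepwise_ex c 2.
exists (fun t p x y => 0 < \sum_(0 <= s < t) (F s [:: p; x] == y.+1)); split.
- apply: computable_leq; first exact: computable_const.
  refine (@computable_sum _ (fun v i => _) _ _ _); last exact: (computable_var _ 0 0).
  apply: computable_eq; last by computable_auto.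
  apply: (@computable_comp _ [:: fun v => nth 0 v 0; fun v => nth 0 (behead v) 1;
    fun v => nth 0 (behead v) 2] _ cF).
  by do !constructor; computable_auto.
- move=> t t' p x y le; rewrite !lt0n; apply: contraNN.
  by move=> /sum_eq0P H; apply/sum_eq0P => i it; apply: H; exact: leq_trans le.
- move=> p x y; rewrite Hc; split=> [Ey|[t]].
    have [//|t Ht] := eF _ _ _ Ey; exists t.+1.
    by rewrite lt0n; apply/negP => /sum_eq0P/(_ t (leqnn _)); rewrite Ht // eqxx.
  rewrite lt0n => H; case: (pselect (exists2 s, s < t & F s [:: enc p; enc x] = (enc y).+1)).
    by move=> [s _ Fs]; exact: sF Fs.
  move=> none; case/negP: H; apply/sum_eq0P => s st.
  by case: eqP => // Fs; case: none; exists s.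
Qed.

(* [(enc p).+1] is the binary numeral whose digits, least significant first,
   are the bits of [p] followed by a leading 1. *)
Lemma enc_cons b s : (enc (b :: s)).+1 = (enc s).+1.*2 + b.
Proof. by rewrite /=; case: b; lia. Qed.

Lemma enc_drop j p : j <= size p -> (enc p).+1 %/ 2 ^ j = (enc (drop j p)).+1.
Proof.
elim: j p => [|j IH] p; first by rewrite expn0 divn1 drop0.
case: p => [|b s] // js; rewrite enc_cons expnS divnMA -IH //.
by congr (_ %/ _); case: (b); lia.
Qed.

Lemma enc_bounds p : 2 ^ size p <= (enc p).+1 < 2 ^ (size p).+1.
Proof.
elim: p => [|b s /andP[lo hi]] //; rewrite enc_cons /= !expnS in hi *.
by apply/andP; split; case: b; lia.
Qed.

Lemma enc_sizeP p k : ((enc p).+1 %/ 2 ^ k == 1) = (size p == k).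
Proof.
have /andP[lo hi] := enc_bounds p.
have k0 : 0 < 2 ^ k by rewrite expn_gt0.
apply/idP/eqP => [/eqP E|<-]; last first.
  rewrite eqn_leq leq_divRL ?expn_gt0 // mul1n lo andbT.
  by rewrite -ltnS ltn_divLR ?expn_gt0 // -expnS.
have : 2 ^ k <= (enc p).+1 by rewrite -[X in X <= _]mul1n -leq_divRL // E.
have : (enc p).+1 < 2 ^ k.+1 by rewrite expnS -ltn_divLR // E.
move=> h1 h2.
have : 2 ^ size p < 2 ^ k.+1 by exact: leq_ltn_trans h1.
have : 2 ^ k < 2 ^ (size p).+1 by exact: leq_ltn_trans hi.
by rewrite !ltn_exp2l //; lia.
Qed.

(** Since the first bit is the least significant digit, zero bits at the head of [p] become factors
    of two. *)
Lemma enc_dvd2 l p : l <= size p ->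
  (2 ^ l %| (enc p).+1) = ~~ has id (take l p).
Proof.
elim: l p => [|l IH] [|b s] //= ls; rewrite ?dvd1n ?take0 //.
rewrite enc_cons expnS negb_or -IH //; case: b => /=.
  by apply/negP => /(dvdn_trans (dvdn_mulr _ (dvdnn 2))); rewrite dvdn2 oddD odd_double.
by rewrite addn0 -muln2 mulnC dvdn_pmul2r.
Qed.

Lemma enc_block s l p : s + l <= size p ->
  (2 ^ l %| (enc p).+1 %/ 2 ^ s) = ~~ has id (take l (drop s p)).
Proof. by move=> sl; rewrite enc_drop ?enc_dvd2 // ?size_drop; lia. Qed.

(** The integer part of the base 2 logarithm of [j + 1], counted exponent by exponent; it is the
    length of the string with code [j]. *)
Definition lenc j := \sum_(0 <= i < j) (2 ^ i.+1 <= j.+1).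

Lemma lenc_enc p : lenc (enc p) = size p.
Proof.
have /andP[lo hi] := enc_bounds p.
have le : size p <= enc p by have := ltn_expl (size p) (isT : 1 < 2); lia.
rewrite -[RHS](minn_idPr le) -sum_ltn; apply: eq_big_nat => i _; congr nat_of_bool.
apply/idP/idP => [H|H].
  by have := leq_ltn_trans H hi; rewrite ltn_exp2l.
by apply: leq_trans lo; rewrite leq_exp2l.
Qed.

Lemma lenc_le j : lenc j <= j.
Proof.
by rewrite -{2}[j](decK j) -{1}(decK j) lenc_enc; have /andP[] := enc_bounds (dec j);
  have := ltn_expl (size (dec j)) (isT : 1 < 2); lia.
Qed.

Lemma computable_lenc k f : computable k f -> computable k (fun v => lenc (f v)).
Proof. by move=> Hf; apply: (@computable_comp1 _ lenc) => //; rewrite /lenc; computable_auto. Qed.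

(* The dyadic interval of reals whose binary expansion starts with [q] is
   [[value q, value q + 1) / 2 ^ size q]. *)
Definition msbval (E k : nat) := \sum_(0 <= i < k) odd (E %/ 2 ^ i) * 2 ^ (k - i.+1).

Fixpoint value (q : bstr) := if q is b :: q' then b * 2 ^ size q' + value q' else 0.

Lemma msbval_enc q : msbval (enc q).+1 (size q) = value q.
Proof.
rewrite /msbval; elim: q => [|b q IH]; first by rewrite big_geq.
rewrite [size _]/= [value _]/= -IH big_nat_recl // expn0 divn1 enc_cons.
rewrite oddD odd_double oddb subSS subn0.
congr (_ + _); apply: eq_big_nat => i /andP[_ ik]; rewrite subSS.
have E1 := @enc_drop i.+1 (b :: q) (ltnW ik); have E2 := @enc_drop i q (ltnW ik).
by rewrite -enc_cons E1 E2.
Qed.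

Lemma value_lt q : value q < 2 ^ size q.
Proof. by elim: q => //= b q IH; rewrite expnS; case: b; lia. Qed.

Lemma value_cat p q : value (p ++ q) = value p * 2 ^ size q + value q.
Proof. by elim: p => //= b p ->; rewrite size_cat expnD; lia. Qed.

Lemma value_surj k z : z < 2 ^ k -> exists2 q, size q = k & value q = z.
Proof.
elim: k z => [|k IH] z lt; first by exists [::] => //; case: z lt.
rewrite expnS in lt.
have [ge|zlt] := leqP (2 ^ k) z.
  have [|q sq vq] := IH (z - 2 ^ k); first by lia.
  by exists (true :: q); rewrite /= ?sq // vq; lia.
by have [q sq vq] := IH z zlt; exists (false :: q); rewrite /= ?sq // vq.
Qed.

(** * Coin tossing *)

Lemma sum_le1 n (b : nat -> bool) :
  (forall i j, i < n -> j < n -> b i -> b j -> i = j) ->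
  \sum_(0 <= i < n) b i <= 1.
Proof.
move=> b1; case: (pselect (exists2 i, i < n & b i)) => [[i ltin bi]|none].
  rewrite (@sum_single _ _ i) //; first by case: (b i).
  by move=> j ltjn /negP ji; case bj: (b j) => //; case: ji; rewrite (b1 j i).
suff /sum_eq0P/eqP -> : forall i, i < n -> b i = 0 :> nat by [].
by move=> i ltin; case bi: (b i) => //; case: none; exists i.
Qed.

Section CoinTossing.
Variable R : realType.
Local Open Scope ring_scope.

Definition weight n : R := 2^-1 ^+ n.

Lemma weight_gt0 n : 0 < weight n.
Proof. by rewrite exprn_gt0. Qed.
Lemma weight_ge0 n : 0 <= weight n.
Proof. exact: ltW (weight_gt0 n). Qed.

Lemma weightS n : weight n.+1 = weight n / 2.
Proof. by rewrite /weight exprSr. Qed.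

Lemma weightD m n : weight (m + n) = weight m * weight n.
Proof. exact: exprD. Qed.

Lemma weight_pow n : weight n * 2 ^+ n = 1.
Proof. by rewrite /weight -exprMn mulVf ?expr1n // pnatr_eq0. Qed.

Lemma weightE m k : (k <= m)%N -> (2 ^ (m - k))%:R = weight k * 2 ^+ m :> R.
Proof.
by move=> km; rewrite -[in RHS](subnKC km) exprD mulrA weight_pow mul1r natrX.
Qed.

Lemma weight_le m n : (m <= n)%N -> weight n <= weight m.
Proof. by move=> mn; apply: ler_wiXn2l => //; rewrite invf_le1 ?ltr0n ?ler1n. Qed.

(** Expectation over [n] fair coin tosses, by recursion on the first toss so that independence
    follows by induction; [avgE] recovers the counting form. *)
Fixpoint avg n (f : bstr -> R) : R :=
  if n is m.+1 then (avg m (fun s => f (true :: s)) + avg m (fun s => f (false :: s))) / 2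
  else f [::].

Lemma avg_le n f g : (forall s, size s = n -> f s <= g s) -> avg n f <= avg n g.
Proof.
elim: n f g => [|n IH] f g fg /=; first exact: fg.
by rewrite ler_pM2r ?invr_gt0 ?ltr0n // lerD //; apply: IH => s sn; apply: fg; rewrite /= sn.
Qed.

Lemma eq_avg n f g : (forall s, size s = n -> f s = g s) -> avg n f = avg n g.
Proof. by move=> fg; apply/eqP; rewrite eq_le !avg_le // => s /fg ->. Qed.

Lemma avg_cst n c : avg n (fun=> c) = c.
Proof. by elim: n => //= n ->; rewrite mulrDl -splitr. Qed.

Lemma avgD n f g : avg n (fun s => f s + g s) = avg n f + avg n g.
Proof. by elim: n f g => //= n IH f g; rewrite !IH -mulrDl addrACA. Qed.

Lemma avgZ n c f : avg n (fun s => c * f s) = c * avg n f.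
Proof. by elim: n f => //= n IH f; rewrite !IH -mulrDr mulrA. Qed.

Lemma avg_sum n (I : Type) (r : seq I) (P : pred I) (F : I -> bstr -> R) :
  avg n (fun s => \sum_(i <- r | P i) F i s) = \sum_(i <- r | P i) avg n (F i).
Proof.
elim: r => [|i r IH].
  by rewrite big_nil -[RHS](avg_cst n); apply: eq_avg => s _; rewrite big_nil.
rewrite big_cons -IH; case Pi : (P i); last by apply: eq_avg => s _; rewrite big_cons Pi.
by rewrite -avgD; apply: eq_avg => s _; rewrite big_cons Pi.
Qed.

Lemma avgE n f : avg n f = (\sum_(s : n.-tuple bool) f s) / 2 ^+ n.
Proof.
elim: n f => [|n IH] f /=.
  by rewrite expr0 divr1 (big_pred1 [tuple]) // => s; apply/esym/eqP; exact: tuple0.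
rewrite !IH -mulrDl exprSr invfM mulrA; congr (_ / _ / _).
rewrite (reindex (fun bs : bool * n.-tuple bool => [tuple of bs.1 :: bs.2])) /=; last first.
  exists (fun s => (thead s, [tuple of behead s])) => [[b s] _|s _].
    by congr pair; apply: val_inj.
  by apply: val_inj; rewrite /= [in RHS](tuple_eta s).
rewrite -(pair_big xpredT xpredT (fun b (s : n.-tuple bool) => f (b :: s))) /=.
by rewrite big_bool.
Qed.

Lemma e_approxE U x y n :
  e_approx U x y n = avg n (fun s => (outputs_on U s x y && outputs_on U s y x)%:R).
Proof.
rewrite avgE /e_approx; congr (_ / _).
rewrite -natr_sum -sum1_card big_mkcond; congr (_%:R); apply: eq_bigr => s _.
rewrite (_ : s \in _ = outputs_on U s x y && outputs_on U s y x); first by case: (_ && _).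
by apply/idP/idP; rewrite inE.
Qed.

Lemma avg_prefix n p : (size p <= n)%N ->
  avg n (fun s => (prefix p s)%:R) = weight (size p).
Proof.
elim: p n => [|b p IH] n pn; first by rewrite -[RHS](avg_cst n); apply: eq_avg => s _; rewrite prefix0s.
case: n pn => // n pn /=; rewrite weightS -(IH n) //; congr (_ / _).
have avg0 : avg n (fun=> 0) = 0 by exact: avg_cst.
by case: (b); rewrite /= avg0 ?addr0 ?add0r.
Qed.

Lemma avg_prefix_le n p : avg n (fun s => (prefix p s)%:R) <= weight (size p).
Proof.
have [pn|np] := leqP (size p) n; first by rewrite avg_prefix.
apply: le_trans (weight_ge0 _); rewrite -[leRHS](avg_cst n); apply: avg_le => s sn.
by case E: (prefix p s) => //; have := size_prefix E; rewrite sn leqNgt np.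
Qed.

(** * Independence of disjoint blocks of coin tosses *)

Fixpoint zeros (Z : pred nat) (s : bstr) : bool :=
  if s is b :: s' then ~~ (Z 0%N && b) && zeros (fun i => Z i.+1) s' else true.

Lemma eq_zeros Z Z' s : Z =1 Z' -> zeros Z s = zeros Z' s.
Proof. by elim: s Z Z' => //= b s IH Z Z' ZZ'; rewrite ZZ' (IH _ (fun i => Z' i.+1)). Qed.

Lemma zerosU Z Z' s : zeros (predU Z Z') s = zeros Z s && zeros Z' s.
Proof.
elim: s Z Z' => //= b s IH Z Z'.
rewrite (_ : zeros _ s = zeros (predU (fun i => Z i.+1) (fun i => Z' i.+1)) s) //.
by rewrite IH; case: (Z 0%N); case: (Z' 0%N); case: b => //=; rewrite andbF.
Qed.

Lemma zeros_block k l s :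
  zeros (fun i => (k <= i < k + l)%N) s = ~~ has id (take l (drop k s)).
Proof.
elim: s k l => [|b s IH] [|k] [|l] //=; rewrite ?take0 ?drop0 //.
- by rewrite (@eq_zeros _ (fun i => (0 <= i < 0 + 0)%N)) ?IH ?take0.
- rewrite (@eq_zeros _ (fun i => (0 <= i < 0 + l)%N)) ?IH ?drop0; last by move=> i; rewrite !add0n.
  by case: b.
- rewrite (@eq_zeros _ (fun i => (k <= i < k + 0)%N)) ?IH ?take0 //; by move=> i; rewrite addSn !ltnS.
- rewrite (@eq_zeros _ (fun i => (k <= i < k + l.+1)%N)) ?IH //; by move=> i; rewrite addSn !ltnS.
Qed.

(** Each position of [Z] below [n] contributes a factor one half, every other position a factor
    one. *)
Lemma avg_zeros n Z :
  avg n (fun s => (zeros Z s)%:R) = weight (count Z (iota 0 n)).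
Proof.
elim: n Z => [|n IH] Z //=.
rewrite -[1%N]/(1 + 0)%N iotaDl count_map.
have E b : avg n (fun s => (~~ (Z 0%N && b) && zeros (fun i => Z i.+1) s)%:R)
    = (~~ (Z 0%N && b))%:R * weight (count (fun i => Z i.+1) (iota 0 n)).
  by rewrite -IH -avgZ; apply: eq_avg => s _; rewrite -natrM mulnb.
rewrite !E -mulrDl; case: (Z 0%N) => /=.
  by rewrite add0r mul1r [in RHS]add1n weightS.
by rewrite add0n mulrAC -mulr2n -[1 *+ 2]/2%:R mulfV ?mul1r // pnatr_eq0.
Qed.

Lemma count_interval k l n : (k + l <= n)%N ->
  count (fun i => k <= i < k + l)%N (iota 0 n) = l.
Proof.
move=> kln; rewrite -(subnKC kln) !iotaD !count_cat !add0n.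
rewrite (@eq_in_count _ _ pred0) ?count_pred0 => [|i]; last by rewrite mem_iota /=; lia.
rewrite (@eq_in_count _ _ predT) ?count_predT ?size_iota => [|i]; last by rewrite mem_iota /=; lia.
rewrite (@eq_in_count _ _ pred0) ?count_pred0 => [|i]; last by rewrite mem_iota /=; lia.
by rewrite addn0.
Qed.

Lemma avg_block k l n : (k + l <= n)%N ->
  avg n (fun s => (~~ has id (take l (drop k s)))%:R) = weight l.
Proof.
move=> kln; rewrite -[in RHS](count_interval kln) -avg_zeros.
by apply: eq_avg => s _; rewrite zeros_block.
Qed.

(** Two disjoint blocks together form a set of [l + l'] positions, so [avg_zeros] yields a
    product. *)
Lemma avg_block2 k l k' l' n : (k + l <= k')%N -> (k' + l' <= n)%N ->
  avg n (fun s => (~~ has id (take l (drop k s)) && ~~ has id (take l' (drop k' s)))%:R)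
    = weight l * weight l'.
Proof.
move=> klk' kln.
have E : count (predU (fun i => k <= i < k + l)%N (fun i => k' <= i < k' + l')%N) (iota 0 n)
    = (l + l')%N.
  have kln' : (k + l <= n)%N by lia.
  rewrite -[RHS](congr2 addn (count_interval kln') (count_interval kln)) -count_predUI.
  rewrite (_ : count (predI _ _) _ = 0%N) ?addn0 //.
  by apply/(etrans _ (count_pred0 (iota 0 n)))/eq_count => i /=; lia.
rewrite -weightD -E -avg_zeros; apply: eq_avg => s _.
by rewrite zerosU !zeros_block.
Qed.

Lemma geometric_le (m : R) N : 0 <= m ->
  \sum_(0 <= n < N | weight n <= m) weight n <= 2 * m.
Proof.
move=> m0; suff : \sum_(0 <= n < N.+1 | weight n <= m) weight n <=
    if weight N <= m then 2 * m - weight N else 0.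
  move=> H; rewrite big_mkcond big_nat_recr //= -big_mkcond /= in H.
  have := weight_ge0 N; case: ifP H => _; lra.
elim: N => [|N IH].
  by rewrite big_mkcond big_nat1; case: ifP => // H; rewrite /weight expr0 in H *; lra.
rewrite big_mkcond big_nat_recr //= -big_mkcond /=.
have := weight_gt0 N; have := weightS N; move: IH.
by case: ifP; case: ifP; lra.
Qed.

(* The exponents attached to one index [g r] are distinct, so they sum geometrically
   to at most twice the mass of that index. *)
Lemma request_weight (m : nat -> R) N (P : pred nat) (g d : nat -> nat) :
  (forall y, 0 <= m y) -> \sum_(0 <= y < N) m y <= 1 ->
  (forall r, (r < N)%N -> P r -> [/\ (g r < N)%N, (d r < N)%N & weight (d r) <= m (g r)]) ->
  (forall r s, (r < N)%N -> (s < N)%N -> P r -> P s -> g r = g s -> d r = d s -> r = s) ->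
  \sum_(0 <= r < N | P r) weight (d r) <= 2.
Proof.
move=> m0 m1 Pm Pinj; case: N => [|N] in m1 Pm Pinj *; first by rewrite big_geq // ler0n.
pose h (r : 'I_N.+1) : 'I_N.+1 * 'I_N.+1 := (inord (g r), inord (d r)).
pose A := [set r : 'I_N.+1 | P r].
have hinj : {in A &, injective h}.
  move=> r s; rewrite !inE => Pr Ps [/(congr1 val) + /(congr1 val)].
  have [? ? _] := Pm _ (ltn_ord r) Pr; have [? ? _] := Pm _ (ltn_ord s) Ps.
  by rewrite /= !inordK // => gE dE; apply: val_inj; exact: Pinj gE dE.
pose F (p : 'I_N.+1 * 'I_N.+1) := weight p.2.
have -> : \sum_(0 <= r < N.+1 | P r) weight (d r) = \sum_(p in h @: A) F p.
  rewrite big_imset //= big_mkord; apply: eq_big => [r|r Pr]; first by rewrite inE.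
  by rewrite /F /= inordK //; have [] := Pm _ (ltn_ord r) Pr.
apply: (@le_trans _ _ (\sum_(y < N.+1) \sum_(n < N.+1 | weight n <= m y) weight n)).
  rewrite pair_big_dep /= big_mkcond [leRHS]big_mkcond; apply: ler_sum => p _ /=.
  case: ifP => [/imsetP[r]|_]; last by case: ifP => // _; exact: weight_ge0.
  rewrite inE => Pr ->; have [? ? le] := Pm _ (ltn_ord r) Pr.
  by rewrite /F /= !inordK // le lexx.
apply: (@le_trans _ _ (\sum_(y < N.+1) 2 * m y)).
  by apply: ler_sum => y _; have := @geometric_le (m y) N.+1 (m0 y); rewrite big_mkord.
by rewrite -mulr_sumr -[leRHS]mulr1 ler_pM2l ?ltr0n // -[X in X <= _](big_mkord xpredT m).
Qed.

End CoinTossing.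

(** * Requests and Kraft's inequality *)

#[local] Hint Extern 0 (is_true (0 <= weight _ _)%R) => exact: weight_ge0 : core.
#[local] Hint Extern 0 (is_true (0 < weight _ _)%R) => exact: weight_gt0 : core.

(** Every positive number is uniquely a power of two times an odd number; shifted by one, this is a
    bijection between pairs and naturals, with [fst2] a 2-adic valuation. *)
Definition pair2 a b := (2 ^ a * b.*2.+1).-1.
Definition fst2 r := logn 2 r.+1.
Definition snd2 r := r.+1 %/ 2 ^ (fst2 r).+1.

Lemma pair2S a b : (pair2 a b).+1 = 2 ^ a * b.*2.+1.
Proof. by rewrite prednK // muln_gt0 expn_gt0. Qed.

Lemma fst2K a b : fst2 (pair2 a b) = a.
Proof.
rewrite /fst2 pair2S lognM ?expn_gt0 // pfactorK //.
by rewrite logn_coprime ?addn0 // coprime2n /= odd_double.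
Qed.

Lemma snd2K a b : snd2 (pair2 a b) = b.
Proof.
rewrite /snd2 fst2K pair2S expnS [2 * _]mulnC divnMA mulKn ?expn_gt0 //; lia.
Qed.

Lemma pair2K r : pair2 (fst2 r) (snd2 r) = r.
Proof.
apply: succn_inj; rewrite pair2S /snd2 expnS [2 * _]mulnC divnMA.
have dvd : 2 ^ fst2 r %| r.+1 by exact: pfactor_dvdnn.
rewrite -[RHS](divnK dvd) mulnC; congr (_ * _).
have : ~~ (2 %| r.+1 %/ 2 ^ fst2 r).
  apply/negP => d2; have : 2 ^ (fst2 r).+1 %| r.+1.
    by rewrite -(divnK dvd) expnS dvdn_pmul2r ?expn_gt0.
  by rewrite pfactor_dvdn // ltnn.
by rewrite dvdn2 negbK; have := odd_double_half (r.+1 %/ 2 ^ fst2 r); lia.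
Qed.

Lemma fst2_le r : fst2 r <= r.
Proof. by rewrite -ltnS; exact: ltn_logl. Qed.

Lemma snd2_le r : snd2 r <= r.
Proof.
rewrite /snd2 expnS divnMA; apply: leq_trans (leq_div _ _) _; lia.
Qed.

Lemma computable_fst2 k f : computable k f -> computable k (fun v => fst2 (f v)).
Proof. exact: computable_logn. Qed.

Lemma computable_snd2 k f : computable k f -> computable k (fun v => snd2 (f v)).
Proof.
by move=> Hf; apply: computable_div2; [exact: computable_succ|apply: computable_succ; exact: computable_fst2].
Qed.

(* A request [r] packs a stage, an ordered pair of (codes of) strings and an exponent. *)
Definition stage r := fst2 r.
Definition source r := fst2 (snd2 r).
Definition target r := fst2 (snd2 (snd2 r)).
Definition expo r := snd2 (snd2 (snd2 r)).

Lemma request_inj r s : stage r = stage s -> source r = source s ->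
  target r = target s -> expo r = expo s -> r = s.
Proof.
move=> e1 e2 e3 e4; rewrite -(pair2K r) -(pair2K s); congr pair2 => //.
rewrite -(pair2K (snd2 r)) -(pair2K (snd2 s)); congr pair2 => //.
by rewrite -(pair2K (snd2 (snd2 r))) -(pair2K (snd2 (snd2 s))); congr pair2.
Qed.

Lemma request_ex t a b n :
  exists r, [/\ stage r = t, source r = a, target r = b & expo r = n].
Proof.
exists (pair2 t (pair2 a (pair2 b n))).
by rewrite /stage /source /target /expo !(fst2K, snd2K).
Qed.

(** Sums over requests below [N] thus involve only stages, strings and exponents below [N], and
    differences such as [r - expo r] do not truncate. *)
Lemma request_le r : [/\ stage r <= r, source r <= r, target r <= r & expo r <= r].
Proof.
have le1 := snd2_le r; have le2 := leq_trans (snd2_le _) le1.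
by split; rewrite ?fst2_le // ?(leq_trans (fst2_le _)) // (leq_trans (snd2_le _)).
Qed.

Lemma computable_source k f : computable k f -> computable k (fun v => source (f v)).
Proof. by move=> Hf; apply/computable_fst2/computable_snd2. Qed.

Lemma computable_target k f : computable k f -> computable k (fun v => target (f v)).
Proof. by move=> Hf; apply/computable_fst2/computable_snd2/computable_snd2. Qed.

Lemma computable_expo k f : computable k f -> computable k (fun v => expo (f v)).
Proof. by move=> Hf; apply/computable_snd2/computable_snd2/computable_snd2. Qed.

Section FreshRequests.
Variable Q : nat -> nat -> nat -> nat -> bool.
Hypothesis Qmono : forall t t' a b n, t <= t' -> Q t a b n -> Q t' a b n.

(* Each triple (source, target, exponent) is requested only once, at the first stage where [Q] holds. *)
Definition fresh r :=
  Q (stage r) (source r) (target r) (expo r) &&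
  ~~ ((0 < stage r) && Q (stage r).-1 (source r) (target r) (expo r)).

Lemma computable_fresh k f :
  computable 4 (fun v => Q (nth 0 v 0) (nth 0 v 1) (nth 0 v 2) (nth 0 v 3)) ->
  computable k f -> computable k (fun v => fresh (f v)).
Proof.
move=> cQ cf.
have ct : computable k (fun v => stage (f v)) by exact: computable_fst2.
have ca := computable_source cf; have cb := computable_target cf; have cn := computable_expo cf.
apply: computable_and; first exact: (@computable_comp4 _ (fun t a b n => Q t a b n)).
apply: computable_neg; apply: computable_and; first by apply: computable_leq => //; exact: computable_const.
by apply: (@computable_comp4 _ (fun t a b n => Q t a b n)) => //; exact: computable_predn.
Qed.

Lemma fresh_ex t a b n : Q t a b n ->
  exists r, [/\ fresh r, source r = a, target r = b & expo r = n].
Proof.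
move=> Qt; have ex : exists t, Q t a b n by exists t.
have [r [rt ra rb rn]] := request_ex (ex_minn ex) a b n; exists r; split=> //.
rewrite /fresh rt ra rb rn; case: ex_minnP => m Qm mmin; rewrite Qm /=.
by apply/negP => /andP[m0 /mmin]; lia.
Qed.

Lemma fresh_inj r s : fresh r -> fresh s -> source r = source s ->
  target r = target s -> expo r = expo s -> r = s.
Proof.
move=> /andP[Qr Nr] /andP[Qs Ns] ea eb en.
apply: request_inj => //; case: (ltngtP (stage r) (stage s)) => // lt.
  case/negP: Ns; rewrite (leq_ltn_trans _ lt) //=.
  by rewrite ea eb en in Qr; apply: Qmono Qr; lia.
case/negP: Nr; rewrite (leq_ltn_trans _ lt) //=.
by rewrite ea eb en; apply: Qmono (Qs); lia.
Qed.

End FreshRequests.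

(** * Mass of the programs seen by a given stage, and Kraft's inequality *)

Lemma prefix_comparable (p q s : bstr) :
  prefix p s -> prefix q s -> size p <= size q -> prefix p q.
Proof.
rewrite !prefixE => /eqP ep /eqP eq le; apply/eqP.
by rewrite -eq take_takel.
Qed.

Definition enumerates (W : pfun2) (h : nat -> nat -> nat -> nat -> bool) :=
  (forall t t' p x y, t <= t' -> h t p x y -> h t' p x y) /\
  (forall p x y, W p x = Some y <-> exists t, h t (enc p) (enc x) (enc y)).

(* The inequality m_t(y|x) >= 2 ^ -n at stage [t], multiplied by 2 ^ (t + n) to stay in [nat]. *)
Definition heavy (h : nat -> nat -> nat -> nat -> bool) t x y n :=
  2 ^ t <= \sum_(0 <= j < t) h t j x y * 2 ^ (t + n - lenc j).

Lemma computable_heavy (h : nat -> nat -> nat -> nat -> bool) :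
  computable 4 (fun v => h (nth 0 v 0) (nth 0 v 1) (nth 0 v 2) (nth 0 v 3)) ->
  computable 4 (fun v => heavy h (nth 0 v 0) (nth 0 v 1) (nth 0 v 2) (nth 0 v 3)).
Proof.
move=> ch; apply: computable_leq; first by computable_auto.
refine (@computable_sum _ (fun v i => _) _ _ _); last by computable_auto.
apply: computable_mul; first by apply: (@computable_comp4 _ (fun t j x y => h t j x y)) => //;
  computable_auto.
apply: computable_expn; first by computable_auto.
by apply: computable_sub; [computable_auto|apply: computable_lenc; computable_auto].
Qed.

Section Mass.
Variables (R : realType) (W : pfun2) (h : nat -> nat -> nat -> nat -> bool).
Hypothesis Wh : enumerates W h.
Local Open Scope ring_scope.

Definition mass t x y : R := \sum_(0 <= j < t) (h t j x y)%:R * weight R (lenc j).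

(** Links the integer test that a machine can run with the real inequality; no subtraction
    truncates, since [lenc j <= j < t]. *)
Lemma heavyE t x y n : heavy h t x y n = (weight R n <= mass t x y).
Proof.
rewrite /heavy -(ler_nat R) -{1}(addnK n t) weightE ?leq_addl // natr_sum.
rewrite (_ : \sum_(0 <= j < t) _ = mass t x y * 2 ^+ (t + n)).
  by rewrite ler_pM2r // exprn_gt0.
rewrite mulr_suml; apply: eq_big_nat => j /andP[_ jt].
by rewrite natrM weightE ?mulrA // (leq_trans (lenc_le j)) // (leq_trans (ltnW jt)) ?leq_addr.
Qed.

Lemma mass_ge0 t x y : 0 <= mass t x y.
Proof. by apply: sumr_ge0 => j _; rewrite mulr_ge0. Qed.

Lemma mass_mono t t' x y : (t <= t')%N -> mass t x y <= mass t' x y.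
Proof.
move=> tt'; rewrite /mass [leRHS](@big_cat_nat _ _ _ t) //= -[leLHS]addr0 lerD //.
  apply: ler_sum => j _; rewrite ler_wpM2r // ler_nat.
  by case E : (h t j x y) => //; rewrite (Wh.1 _ _ _ _ _ tt' E).
by apply: sumr_ge0 => j _; rewrite mulr_ge0.
Qed.

Lemma heavy_mono t t' x y n : (t <= t')%N -> heavy h t x y n -> heavy h t' x y n.
Proof. by move=> tt'; rewrite !heavyE => /le_trans; apply; exact: mass_mono. Qed.

Lemma halts_dec t j x y : h t j x y -> W (dec j) (dec x) = Some (dec y).
Proof. by move=> hj; apply/Wh.2; exists t; rewrite !decK. Qed.

Lemma lencE j : lenc j = size (dec j).
Proof. by rewrite -lenc_enc decK. Qed.

Lemma size_dec_le j : (size (dec j) <= j)%N.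
Proof. by rewrite -lencE lenc_le. Qed.

(** Two halting programs that are prefixes of the same [s] are comparable, hence equal by
    prefix-freeness, and one program has only one output on [x]. *)
Lemma sum_halts_le1 t N x s : prefix_free W ->
  (\sum_(0 <= y < N) \sum_(0 <= j < t) h t j x y && prefix (dec j) s <= 1)%N.
Proof.
move=> pfW; rewrite exchange_big /=.
pose b j := [exists y : 'I_N, h t j x y] && prefix (dec j) s.
apply: (@leq_trans (\sum_(0 <= j < t) b j)); last first.
  apply: sum_le1 => i j _ _ /andP[/existsP[y hi] pi] /andP[/existsP[z hj] pj].
  rewrite -(decK i) -(decK j); congr enc.
  have Di : W (dec i) (dec x) <> None by rewrite (halts_dec hi).
  have Dj : W (dec j) (dec x) <> None by rewrite (halts_dec hj).
  have [le|/ltnW le] := leqP (size (dec i)) (size (dec j)).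
    by apply: pfW Di Dj _; exact: prefix_comparable pi pj le.
  by apply/esym/(pfW _ _ _ Dj Di); exact: prefix_comparable pj pi le.
apply: leq_sum => j _; rewrite /b.
case: (pselect (exists y : 'I_N, h t j x y)) => [ex|none].
  rewrite (introT existsP ex) /=; case: prefix; last first.
    by rewrite big1 // => y _; rewrite andbF.
  rewrite (eq_bigr (fun y => h t j x y : nat)) => [|y _]; last by rewrite andbT.
  apply: sum_le1 => y z _ _ hy hz; rewrite -(decK y) -(decK z); congr enc.
  by apply: Some_inj; rewrite -(halts_dec hy) -(halts_dec hz).
rewrite big_mkord big1 // => y _; case E : (h t j x y) => //.
by case: none; exists y.
Qed.

(** The mass is the expected number of halting programs that are prefixes of a random string, which
    is at most 1 pointwise. Strings of length [t] are long enough, as a program with code below [t]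
    has length below [t]. *)
Lemma kraft t N x : prefix_free W -> \sum_(0 <= y < N) mass t x y <= 1.
Proof.
move=> pfW; rewrite -(avg_cst t 1).
rewrite (_ : \sum_(0 <= y < N) _ = avg t (fun s =>
   (\sum_(0 <= y < N) \sum_(0 <= j < t) h t j x y && prefix (dec j) s)%N%:R)); last first.
  rewrite (@eq_avg _ _ _ (fun s => \sum_(0 <= y < N) \sum_(0 <= j < t)
    (h t j x y)%:R * (prefix (dec j) s)%:R)); last first.
    move=> s _; rewrite natr_sum; apply: eq_bigr => y _.
    by rewrite natr_sum; apply: eq_bigr => j _; rewrite -natrM mulnb.
  rewrite avg_sum; apply: eq_bigr => y _; rewrite avg_sum.
  apply: eq_big_nat => j /andP[_ jt]; rewrite avgZ avg_prefix ?lencE //.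
  exact: leq_trans (size_dec_le j) (ltnW jt).
by apply: avg_le => s _; rewrite -[leRHS]/1%:R ler_nat sum_halts_le1.
Qed.

(** Only the computation of [y] from [x] is kept; a union bound over its programs gives the mass. *)
Lemma e_approx_le_mass x y n :
  exists t, e_approx W x y n <= mass t (enc x) (enc y).
Proof.
have [t0 Ht0] : exists t0, forall t, (t0 <= t)%N -> forall j, (j < 2 ^ n.+1)%N ->
    (W (dec j) x = Some y -> h t j (enc x) (enc y)).
  apply: uniform_bound => j _; case: (pselect (W (dec j) x = Some y)) => [E|NE].
    have [t ht] := (Wh.2 _ _ _).1 E; exists t => t' tt' _.
    by apply: Wh.1 tt' _; rewrite -{1}(decK j).
  by exists 0%N.
(* Prefixes of strings of length [n] have code below [2 ^ n.+1], so stage [t] ranges over all of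
   them, and by [t0] the halting ones have been seen. *)
pose t := maxn t0 (2 ^ n.+1); exists t.
rewrite e_approxE; apply: (@le_trans _ _ (avg n (fun s => \sum_(0 <= j < t)
    (h t j (enc x) (enc y))%:R * (prefix (dec j) s)%:R))).
  apply: avg_le => s sn; case: (boolP (outputs_on W s x y)) => [|_]; last first.
    by apply: sumr_ge0 => j _; rewrite mulr_ge0.
  move=> /existsP[i /eqP Wi]; set p := take i s in Wi.
  have lt : (enc p < 2 ^ n.+1)%N.
    have /andP[_ /ltnW lt] := enc_bounds p; apply: leq_trans lt _.
    by rewrite leq_exp2l // ltnS -sn size_take_min geq_minr.
  have pt : (enc p < t)%N by rewrite (leq_trans lt) // leq_maxr.
  have hp : h t (enc p) (enc x) (enc y) by apply: Ht0; rewrite ?leq_maxl // encK.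
  apply: (@le_trans _ _ ((h t (enc p) (enc x) (enc y))%:R * (prefix (dec (enc p)) s)%:R)).
    by rewrite hp encK /p prefix_take mul1r lern1 leq_b1.
  rewrite big_mkord (bigD1 (Ordinal pt)) //= lerDl.
  by apply: sumr_ge0 => j _; rewrite mulr_ge0.
rewrite avg_sum; apply: ler_sum => j _; rewrite avgZ lencE.
by rewrite ler_wpM2l // avg_prefix_le.
Qed.

(** One endpoint is fixed to [x] and [g] reads the other. Stages of requests below [N] are below
    [N], so the masses at stage [N] dominate and [kraft] applies there. *)
Lemma fresh_weight (Q : nat -> nat -> nat -> nat -> bool) (P : pred nat) (g : nat -> nat) x N :
  prefix_free W ->
  (forall t t' a b n, (t <= t')%N -> Q t a b n -> Q t' a b n) ->
  (forall r, P r -> fresh Q r) -> (forall r, g r <= r)%N ->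
  (forall r, P r -> heavy h (stage r) x (g r) (expo r)) ->
  (forall r s, P r -> P s -> g r = g s -> source r = source s /\ target r = target s) ->
  \sum_(0 <= r < N | P r) weight R (expo r) <= 2.
Proof.
move=> pfW Qmono PQ gle Pheavy Pg.
apply: (@request_weight R (mass N x) _ P g) => [y||r rN Pr|r s _ _ Pr Ps eg en].
- exact: mass_ge0.
- exact: kraft.
- have [st _ _ en] := request_le r; split; [exact: leq_ltn_trans (gle r) rN|exact: leq_ltn_trans en rN|].
  have := Pheavy _ Pr; rewrite heavyE => /le_trans; apply; apply: mass_mono.
  exact: ltnW (leq_ltn_trans st rN).
- have [ea eb] := Pg _ _ Pr Ps eg.
  by apply: (fresh_inj Qmono) => //; exact: PQ.
Qed.

End Mass.

(** * The coding theorem *)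

Section CodingTheorem.
Variable h : nat -> nat -> nat -> nat -> bool.

Definition allotted x r := fresh (heavy h) r && (source r == x).

(** The left end of the interval reserved for [r], in units of [2 ^ -(r + 2)]: an earlier request
    [i] takes length [2 ^ -(expo i + 1)], and [expo i <= i] keeps the count integral. *)
Definition offset x r := \sum_(0 <= i < r) allotted x i * 2 ^ (r.+1 - expo i).

(** The program has length [expo r + 2], and its dyadic interval lies inside the interval reserved
    for [r], again in units of [2 ^ -(r + 2)]. *)
Definition coded r p x :=
  let v := msbval p.+1 (expo r + 2) in
  [&& p.+1 %/ 2 ^ (expo r + 2) == 1, allotted x r,
      offset x r <= v * 2 ^ (r - expo r) &
      v.+1 * 2 ^ (r - expo r) <= offset x r + 2 ^ (r.+1 - expo r)].

Definition coder := search coded (fun r _ _ => target r).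

Lemma computable_allotted k f g :
  computable 4 (fun v => h (nth 0 v 0) (nth 0 v 1) (nth 0 v 2) (nth 0 v 3)) ->
  computable k f -> computable k g -> computable k (fun v => allotted (f v) (g v)).
Proof.
move=> /computable_heavy ch cf cg; apply: computable_and; first exact: (@computable_fresh (heavy h)).
by apply: computable_eq => //; exact: computable_source.
Qed.

Lemma computable_msbval k f g :
  computable k f -> computable k g -> computable k (fun v => msbval (f v) (g v)).
Proof. by move=> cf cg; apply: (@computable_comp2 _ msbval) => //; rewrite /msbval; computable_auto. Qed.

Lemma coder_computable :
  computable 4 (fun v => h (nth 0 v 0) (nth 0 v 1) (nth 0 v 2) (nth 0 v 3)) -> computable2 coder.
Proof.
move=> ch; apply: search_computable; last by apply: computable_target; computable_auto.
have c0 : computable 3 (fun v => nth 0 v 0) by computable_auto.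
have c1 : computable 3 (fun v => nth 0 v 1) by computable_auto.
have c2 : computable 3 (fun v => nth 0 v 2) by computable_auto.
have ce : computable 3 (fun v => expo (nth 0 v 0)) by exact: computable_expo.
have co : computable 3 (fun v => offset (nth 0 v 2) (nth 0 v 0)).
  apply: (@computable_comp2 _ offset) => //.
  refine (@computable_sum _ (fun v i => _) _ _ _); last by computable_auto.
  apply: computable_mul; first by apply: computable_allotted => //; computable_auto.
  by apply: computable_expn; [|apply: computable_sub; [|apply: computable_expo]]; computable_auto.
have cv : computable 3 (fun v => msbval (nth 0 v 1).+1 (expo (nth 0 v 0) + 2)).
  by apply: computable_msbval; [computable_auto|apply: computable_add => //; computable_auto].
have cp : computable 3 (fun v => 2 ^ (nth 0 v 0 - expo (nth 0 v 0))).
  by apply: computable_expn; [computable_auto|apply: computable_sub].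
have cp' : computable 3 (fun v => 2 ^ ((nth 0 v 0).+1 - expo (nth 0 v 0))).
  by apply: computable_expn; [computable_auto|apply: computable_sub => //; computable_auto].
apply: computable_and.
  apply: computable_eq; last by computable_auto.
  by apply: computable_div2; [computable_auto|apply: computable_add => //; computable_auto].
apply: computable_and; first exact: computable_allotted.
apply: computable_and; first by apply: computable_leq => //; exact: computable_mul.
apply: computable_leq; last exact: computable_add.
by apply: computable_mul => //; exact: computable_succ.
Qed.

Variable R : realType.
Local Notation weight := (weight R).

Definition left_end x r : R := (\sum_(0 <= i < r | allotted x i) weight (expo i).+1)%R.

Lemma offsetE x r : ((offset x r)%:R = left_end x r * 2 ^+ r.+2)%R.
Proof.
rewrite /offset natr_sum mulr_suml [RHS]big_mkcond; apply: eq_big_nat => i /andP[_ ir].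
case: allotted; rewrite ?mul0n // mul1n.
have [_ _ _ le] := request_le i.
by rewrite -(subSS (expo i)) weightE //; lia.
Qed.

Lemma codedP r q x : coded r (enc q) x ->
  [/\ size q = expo r + 2, allotted x r,
      (left_end x r <= (value q)%:R * weight (size q))%R &
      ((value q).+1%:R * weight (size q) <= left_end x r + weight (expo r).+1)%R].
Proof.
have [_ _ _ le] := request_le r.
rewrite /coded enc_sizeP => /and4P[/eqP sq Pr lo hi]; split=> //.
all: have p0 : (0 < 2 ^+ r.+2 :> R)%R by rewrite exprn_gt0.
all: have wE : (weight (size q) * 2 ^+ r.+2 = (2 ^ (r - expo r))%:R :> R)%R.
1,3: by rewrite -weightE sq; [congr (_ ^ _)%:R; lia|lia].
- rewrite -(ler_pM2r p0) -offsetE -mulrA wE -natrM ler_nat.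
  by move: lo; rewrite -sq msbval_enc.
- have wE' : (weight (expo r).+1 * 2 ^+ r.+2 = (2 ^ (r.+1 - expo r))%:R :> R)%R.
    by rewrite -weightE; [congr (_ ^ _)%:R; lia|lia].
  rewrite -(ler_pM2r p0) mulrDl -offsetE -mulrA wE wE' -natrM -natrD ler_nat.
  by move: hi; rewrite -sq msbval_enc.
Qed.

Lemma left_end_mono x r s : r < s -> allotted x r ->
  (left_end x r + weight (expo r).+1 <= left_end x s)%R.
Proof.
move=> rs Pr; rewrite /left_end [leRHS](@big_cat_nat _ _ _ r.+1) //=.
rewrite [in leRHS]big_mkcond big_nat_recr //= -big_mkcond Pr /= lerDl.
exact: sumr_ge0.
Qed.

(** The dyadic interval of an extension is nested in that of its prefix, whereas the intervals
    reserved for different requests on [x] are disjoint. *)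
Lemma coded_prefix r s p q x :
  coded r (enc p) x -> coded s (enc q) x -> prefix p q -> r = s.
Proof.
move=> /codedP[_ Pr lor hir] + /prefixP[u qE]; subst q => /codedP[_ Ps los his].
set q := p ++ u in los his *.
have wpq : (weight (size p) = (2 ^ size u)%:R * weight (size q))%R.
  by rewrite size_cat weightD mulrCA natrX [(_ * weight (size u))%R]mulrC weight_pow mulr1.
have lopq : ((value p)%:R * weight (size p) <= (value q)%:R * weight (size q))%R.
  by rewrite wpq mulrA -natrM ler_pM2r // ler_nat value_cat leq_addr.
have hipq : ((value q).+1%:R * weight (size q) <= (value p).+1%:R * weight (size p))%R.
  rewrite wpq mulrA -natrM ler_pM2r // ler_nat value_cat mulSn.
  by rewrite -addnS addnC leq_add2r value_lt.
have inq : ((value q)%:R * weight (size q) < (value q).+1%:R * weight (size q))%R.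
  by rewrite ltr_pM2r // ltr_nat.
case: (ltngtP r s) => // [rs|sr]; exfalso.
  have := left_end_mono rs Pr; lra.
have := left_end_mono sr Ps; lra.
Qed.

Lemma coder_prefix_free : prefix_free coder.
Proof.
move=> x p q.
case E : (coder p x) => [y|] // _; case F : (coder q x) => [z|] // _ pq.
have [r Pr _] := search_Some E; have [s Ps _] := search_Some F.
have rs := coded_prefix Pr Ps pq.
have [sp _ _ _] := codedP Pr; have [sq _ _ _] := codedP Ps.
move: pq; rewrite prefixE sp rs -sq take_size => /eqP -> //.
Qed.

Lemma coder_total W x r : prefix_free W -> enumerates W h -> allotted (enc x) r ->
  exists2 q, size q = expo r + 2 & coder q x = Some (dec (target r)).
Proof.
move=> pfW Wh Pr.
(* The exponents of the requests have total weight at most 2; reserving half of each weight fits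
   into the unit interval. *)
have total : (left_end (enc x) r + weight (expo r).+1 <= 1)%R.
  apply: le_trans (left_end_mono (ltnSn r) Pr) _.
  have H2 : (\sum_(0 <= i < r.+1 | allotted (enc x) i) weight (expo i) <= 2)%R.
    apply: (@fresh_weight R W h Wh (heavy h) _ target (enc x)) => //.
    - by move=> t t' a b n tt'; exact: (heavy_mono R Wh tt').
    - by move=> i /andP[].
    - by move=> i; have [] := request_le i.
    - by move=> i /andP[/andP[+ _] /eqP <-].
    - by move=> i j /andP[_ /eqP ->] /andP[_ /eqP ->].
  rewrite /left_end (eq_bigr (fun i => weight (expo i) / 2))%R => [|i _]; last exact: weightS.
  rewrite -mulr_suml; lra.
have [_ _ _ le] := request_le r.
set D := 2 ^ (r - expo r); have D0 : 0 < D by rewrite expn_gt0.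
(* The quotient [offset / D] rounded up. The reserved interval has length [2 * D], so it contains
   the cell of length [D] starting at [z * D]. *)
pose z := (offset (enc x) r + D.-1) %/ D.
have zD : z * D <= offset (enc x) r + D.-1 by exact: leq_divM.
have zD' : offset (enc x) r + D.-1 < z.+1 * D by exact: ltn_ceil.
have DD : 2 ^ (r.+1 - expo r) = 2 * D by rewrite subSn // expnS.
have zlt : z < 2 ^ (expo r + 2).
  have : offset (enc x) r + 2 ^ (r.+1 - expo r) <= 2 ^ r.+2.
    rewrite -(ler_nat R) natrD offsetE -(subSS (expo r)) weightE; last lia.
    by rewrite natrX -mulrDl -[leRHS]mul1r ler_pM2r ?exprn_gt0 //.
  have -> : r.+2 = expo r + 2 + (r - expo r) by lia.
  rewrite expnD -/D DD => le'.
  rewrite -(ltn_pmul2r D0); lia.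
have [q sq vq] := value_surj zlt; exists q => //.
rewrite /coder (@searchE _ _ _ _ r) //; last first.
  move=> m Pm; apply: (coded_prefix Pm _ (prefix_refl q)).
all: rewrite /coded enc_sizeP sq eqxx Pr -{1}sq -{1}sq msbval_enc vq /= -/D DD.
all: apply/andP; split; nia.
Qed.

End CodingTheorem.

(** The bound is assumed at a finite level [m], since the supremum defining [eU] need not be
    attained. *)
Lemma coding_theorem (R : realType) (U : pfun2) : pf_computable U ->
  exists V : pfun2, pf_computable V /\
    forall x y m n, (weight R n <= e_approx U x y m)%R ->
      exists2 q, size q = n + 2 & V q x = Some y.
Proof.
move=> [/halting_ex[h [ch hmono hU]] pfU].
have Uh : enumerates U h by [].
exists (coder h); split.
  by split; [exact: coder_computable|exact: (@coder_prefix_free h R)].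
move=> x y m n le.
have [t et] := @e_approx_le_mass R U h Uh x y m.
have : heavy h t (enc x) (enc y) n by rewrite (heavyE R); exact: le_trans et.
move=> /(fresh_ex (Q := heavy h))[r [fr rx ry rn]].
have [|q sq Vq] := @coder_total h R U x r pfU Uh; first by rewrite /allotted fr rx eqxx.
by exists q; rewrite ?sq ?rn // Vq ry encK.
Qed.

(** * The block machine *)

Section BlockMachine.
Variable h : nat -> nat -> nat -> nat -> bool.

Definition linked t a b n := heavy h t a b n && heavy h t b a n.

Definition incident x r := fresh linked r && ((source r == x) || (target r == x)).

Definition len r := expo r + 4.
(** Every number owns a block, whether or not it is a fresh request, so block positions are the same
    for all inputs. *)
Definition start r := \sum_(0 <= i < r) len i.
Definition clear r E := 2 ^ len r %| E %/ 2 ^ start r.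

(** The program must end exactly where block [r] ends; blocks of requests that do not involve [x]
    are passed over unread. *)
Definition first_clear r p x :=
  [&& p.+1 %/ 2 ^ (start r + len r) == 1, incident x r, clear r p.+1 &
      \sum_(0 <= i < r) (incident x i && clear i p.+1) == 0].

Definition block_machine :=
  search first_clear (fun r _ x => if source r == x then target r else source r).

Lemma computable_len k f : computable k f -> computable k (fun v => len (f v)).
Proof. by move=> cf; apply: computable_add; [exact: computable_expo|exact: computable_const]. Qed.

Lemma computable_start k f : computable k f -> computable k (fun v => start (f v)).
Proof.
move=> cf; apply: (@computable_comp1 _ start) => //.
refine (@computable_sum _ (fun v i => _) _ _ _); last by computable_auto.
by apply: computable_len; computable_auto.
Qed.

Lemma computable_clear k f g : computable k f -> computable k g -> computable k (fun v => clear (f v) (g v)).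
Proof.
move=> cf cg; apply: computable_dvd2; last exact: computable_len.
by apply: computable_div2 => //; exact: computable_start.
Qed.

Lemma computable_incident k f g :
  computable 4 (fun v => h (nth 0 v 0) (nth 0 v 1) (nth 0 v 2) (nth 0 v 3)) ->
  computable k f -> computable k g -> computable k (fun v => incident (f v) (g v)).
Proof.
move=> /computable_heavy ch cf cg; apply: computable_and.
  apply: (@computable_fresh linked) => //; apply: computable_and => //.
  by apply: (@computable_comp4 _ (fun t a b n => heavy h t a b n)) => //; computable_auto.
by apply: computable_or; apply: computable_eq => //; [exact: computable_source|exact: computable_target].
Qed.

Lemma block_machine_computable :
  computable 4 (fun v => h (nth 0 v 0) (nth 0 v 1) (nth 0 v 2) (nth 0 v 3)) ->
  computable2 block_machine.
Proof.
move=> ch.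
have c0 : computable 3 (fun v => nth 0 v 0) by computable_auto.
apply: search_computable; last first.
  apply: computable_if; last exact: computable_source.
    by apply: computable_eq; [exact: computable_source|computable_auto].
  exact: computable_target.
apply: computable_and.
  apply: computable_eq; last by computable_auto.
  by apply: computable_div2; [computable_auto|apply: computable_add];
    [exact: computable_start|exact: computable_len].
apply: computable_and; first by apply: computable_incident => //; computable_auto.
apply: computable_and; first by apply: computable_clear => //; computable_auto.
apply: computable_eq; last by computable_auto.
refine (@computable_sum _ (fun v i => _) _ _ _) => //.
apply: computable_and; first by apply: computable_incident => //; computable_auto.
by apply: computable_clear; computable_auto.
Qed.

Lemma startS r : start r.+1 = start r + len r.
Proof. by rewrite /start big_nat_recr. Qed.

Lemma start_mono r s : r <= s -> start r <= start s.
Proof. by move=> rs; rewrite /start (big_cat_nat _ rs) //= leq_addr. Qed.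

Lemma clearE r p : start r + len r <= size p ->
  clear r (enc p).+1 = ~~ has id (take (len r) (drop (start r) p)).
Proof. exact: enc_block. Qed.

Lemma clear_prefix r p q : start r + len r <= size p -> prefix p q ->
  clear r (enc q).+1 = clear r (enc p).+1.
Proof.
move=> le /prefixP[u ->]; rewrite !clearE // ?size_cat ?(leq_trans le) ?leq_addr //.
by rewrite !take_drop takel_cat // addnC.
Qed.

Lemma first_clearP r p x : first_clear r (enc p) x ->
  [/\ size p = start r.+1, incident x r, clear r (enc p).+1 &
      forall i, i < r -> incident x i -> ~~ clear i (enc p).+1].
Proof.
rewrite /first_clear enc_sizeP startS => /and4P[/eqP sp Ir Cr /sum_eq0P none].
by split=> // i /none; case: incident; case: clear.
Qed.

(** If [r < s], block [r] is already zero in [q], so the machine could not have gone on to [s]; if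
    [s < r], then [p] would be longer than [q]. *)
Lemma first_clear_prefix r s p q x :
  first_clear r (enc p) x -> first_clear s (enc q) x -> prefix p q -> r = s.
Proof.
move=> /first_clearP[sp Ir Cr _] /first_clearP[sq _ _ Nq] pq.
have le := size_prefix pq.
case: (ltngtP r s) => // [rs|sr]; exfalso.
  by move/negP: (Nq r rs Ir); apply; rewrite (clear_prefix _ pq) // sp startS.
have := start_mono sr; rewrite leqNgt => /negP; apply.
by move: le; rewrite sp sq startS /len; lia.
Qed.

Lemma block_machine_prefix_free : prefix_free block_machine.
Proof.
move=> x p q.
case E : (block_machine p x) => [y|] // _; case F : (block_machine q x) => [z|] // _ pq.
have [r Pr _] := search_Some E; have [s Ps _] := search_Some F.
have rs := first_clear_prefix Pr Ps pq.
have [sp _ _ _] := first_clearP Pr; have [sq _ _ _] := first_clearP Ps.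
move: pq; rewrite prefixE sp rs -sq take_size => /eqP -> //.
Qed.

Lemma block_machineE r p x y : first_clear r (enc p) (enc x) ->
  enc y = (if source r == enc x then target r else source r) ->
  outputs_on block_machine p x y.
Proof.
move=> Pr Ey; apply/existsP; exists ord_max; rewrite take_size.
rewrite /block_machine (@searchE _ _ _ _ r) // -?Ey ?encK //.
by move=> m Pm; exact: first_clear_prefix Pm Pr (prefix_refl p).
Qed.

Variables (R : realType) (V : pfun2).
Hypothesis pfV : prefix_free V.
Hypothesis Vh : enumerates V h.

Lemma linked_mono t t' a b n : t <= t' -> linked t a b n -> linked t' a b n.
Proof. by move=> tt' /andP[H1 H2]; rewrite /linked !(heavy_mono R Vh tt'). Qed.

(** Requests with source [x] weigh at most 2 by the mass of outputs from [x]; [linked] is symmetric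
    in its two strings, so the same holds for target [x]. *)
Lemma incident_weight x N :
  (\sum_(0 <= r < N | incident x r) weight R (expo r) <= 4)%R.
Proof.
have H1 : (\sum_(0 <= r < N | fresh linked r && (source r == x)) weight R (expo r) <= 2)%R.
  apply: (@fresh_weight R V h Vh linked _ target x) => //.
  - exact: linked_mono.
  - by move=> r /andP[].
  - by move=> r; have [] := request_le r.
  - by move=> r /andP[/andP[/andP[+ _] _] /eqP <-].
  - by move=> r s /andP[_ /eqP ->] /andP[_ /eqP ->].
have H2 : (\sum_(0 <= r < N | fresh linked r && (target r == x)) weight R (expo r) <= 2)%R.
  apply: (@fresh_weight R V h Vh linked _ source x) => //.
  - exact: linked_mono.
  - by move=> r /andP[].
  - by move=> r; have [] := request_le r.
  - by move=> r /andP[/andP[/andP[_ +] _] /eqP <-].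
  - by move=> r s /andP[_ /eqP ->] /andP[_ /eqP ->].
apply: le_trans (_ : (2 + 2 <= 4)%R); last by rewrite -natrD.
apply: le_trans (lerD H1 H2); rewrite big_mkcond [X in (_ <= X + _)%R]big_mkcond.
rewrite [X in (_ <= _ + X)%R]big_mkcond -big_split /=; apply: ler_sum => r _.
rewrite /incident; case: fresh => /=; last by rewrite addr0.
by case: (source r == x); case: (target r == x); rewrite /= ?addr0 ?add0r ?lerDl.
Qed.

Lemma e_block_machine r x y : fresh linked r -> source r = enc x -> target r = enc y ->
  (weight R (expo r + 5) <= e_approx block_machine x y (start r.+1))%R.
Proof.
move=> fr rx ry; set N := start r.+1.
pose bad i := incident (enc x) i || incident (enc y) i.
(* Weight at most 4 for each of [x] and [y], and the four extra bits of each block divide the total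
   by 16. *)
have bad_weight : (\sum_(0 <= i < r | bad i) weight R (len i) <= 2^-1)%R.
  have Hx := incident_weight (enc x) r; have Hy := incident_weight (enc y) r.
  have H : (\sum_(0 <= i < r | bad i) weight R (expo i) <= 8)%R.
    apply: le_trans (_ : (4 + 4 <= 8)%R); last by rewrite -natrD.
    apply: le_trans (lerD Hx Hy); rewrite big_mkcond [X in (_ <= X + _)%R]big_mkcond.
    rewrite [X in (_ <= _ + X)%R]big_mkcond -big_split /=; apply: ler_sum => i _.
    by rewrite /bad; do 2!case: incident; rewrite /= ?addr0 ?add0r ?lerDl.
  rewrite (eq_bigr (fun i => weight R (expo i) * weight R 4))%R => [|i _]; last exact: weightD.
  rewrite -mulr_suml (_ : weight R 4 = 16^-1)%R; first lra.
  by rewrite /weight exprVn -natrX.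
have inN i : i <= r -> start i + len i <= N by move=> ir; rewrite -startS start_mono.
pose blk i (s : bstr) := ~~ has id (take (len i) (drop (start i) s)).
have Cr : (avg N (fun s => (blk r s)%:R) = weight R (len r))%R by apply: avg_block; exact: inN.
(* Union bound: if block [r] is zero, either both computations stop there or some earlier bad block
   is zero as well, and the latter block is independent of block [r]. *)
have : (weight R (len r) <= e_approx block_machine x y N +
    \sum_(0 <= i < r | bad i) weight R (len i) * weight R (len r))%R.
  rewrite -Cr e_approxE.
  have -> : (\sum_(0 <= i < r | bad i) weight R (len i) * avg N (fun s => (blk r s)%:R) =
     avg N (fun s => \sum_(0 <= i < r | bad i) (blk i s && blk r s)%:R))%R.
    rewrite avg_sum big_mkcond [RHS]big_mkcond; apply: eq_big_nat => i /andP[_ ir].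
    case: (bad i) => //; rewrite Cr; apply/esym/avg_block2; last exact: inN.
    by rewrite -startS start_mono.
  rewrite -avgD; apply: avg_le => s sN.
  case Br : (blk r s); last by apply: addr_ge0 => //; exact: sumr_ge0.
  case: (pselect (exists2 i, i < r & bad i && blk i s)) => [[i ir /andP[bi Bi]]|none].
    rewrite big_mkord (bigD1 (Ordinal ir)) //= Bi /=.
    by rewrite addrCA lerDl addr_ge0 // sumr_ge0.
  have fc z : incident z r -> (z = enc x) \/ (z = enc y) -> first_clear r (enc s) z.
    move=> Iz zE; rewrite /first_clear enc_sizeP sN -startS eqxx Iz clearE ?sN ?inN //.
    rewrite -/(blk r s) Br /=; apply/sum_eq0P => i ir.
    case Ii : (incident z i) => //; rewrite clearE ?sN ?inN //; last exact: ltnW.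
    rewrite -/(blk i s); case Bi : (blk i s) => //; case: none; exists i => //.
    by rewrite /bad Bi andbT; case: zE => <-; rewrite Ii ?orbT.
  have Ix : incident (enc x) r by rewrite /incident fr rx eqxx.
  have Iy : incident (enc y) r by rewrite /incident fr ry eqxx orbT.
  rewrite (block_machineE (fc _ Ix (or_introl erefl))) ?rx ?eqxx //.
  rewrite (block_machineE (fc _ Iy (or_intror erefl))) ?lerDl ?sumr_ge0 //.
  (* If [x] and [y] coincide, the readout takes the other branch, which returns the same string. *)
  by rewrite rx ry; case: eqP => // ->.
rewrite -mulr_suml => H.
have -> : (weight R (expo r + 5) = weight R (len r) / 2)%R by rewrite /len addnS weightS.
have := weight_gt0 R (len r); nra.
Qed.

End BlockMachine.

Lemma link_machine (R : realType) (V : pfun2) : pf_computable V ->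
  exists U : pfun2, pf_computable U /\
    forall x y p q, V p x = Some y -> V q y = Some x ->
      exists m, (weight R (maxn (size p) (size q) + 5) <= e_approx U x y m)%R.
Proof.
move=> [/halting_ex[h [ch hmono hV]] pfV].
have Vh : enumerates V h by [].
exists (block_machine h); split.
  by split; [exact: block_machine_computable|exact: block_machine_prefix_free].
have reach p x y n : V p x = Some y -> size p <= n ->
    exists t0, forall t, t0 <= t -> heavy h t (enc x) (enc y) n.
  (* From stage [(enc p).+1] on, the program [p] is among the summands of the mass, and by itself
     contributes at least [weight n]. *)
  move=> /hV[t ht] pn; exists (maxn t (enc p).+1) => t'; rewrite geq_max => /andP[tt' pt'].
  rewrite (heavyE R); apply: le_trans (weight_le R pn) _.
  rewrite /mass big_mkord (bigD1 (Ordinal pt')) //= (hmono _ _ _ _ _ tt' ht) mul1r lenc_enc.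
  by rewrite lerDl; apply: sumr_ge0 => j _; rewrite mulr_ge0.
move=> x y p q Vp Vq; set n := maxn _ _.
have [t1 H1] := reach _ _ _ n Vp (leq_maxl _ _).
have [t2 H2] := reach _ _ _ n Vq (leq_maxr _ _).
have : linked h (maxn t1 t2) (enc x) (enc y) n.
  by rewrite /linked H1 ?H2 ?leq_maxl ?leq_maxr.
move=> /fresh_ex[r [fr rx ry <-]].
by exists (start r.+1); exact: (e_block_machine R pfV Vh).
Qed.

(** A machine with a program for every output on every input; comparison with it makes the
    complexity of an optimal machine finite. *)
Lemma unary_machine : exists V : pfun2, pf_computable V /\
  forall x y, exists p, V p x = Some y.
Proof.
pose code_of n : bstr := rcons (nseq n false) true.
(* The numeral of [n] zeros followed by 1, with its additional leading 1, is [2 ^ n + 2 ^ n.+1]. *)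
have encE n : (enc (code_of n)).+1 = 3 * 2 ^ n.
  elim: n => [|n IH] //; rewrite /code_of /= -/(code_of n).
  by rewrite expnS; move: IH; rewrite /code_of; lia.
pose P r p (x : nat) := p.+1 == 3 * 2 ^ r.
have PE r p x : P r (enc p) x -> p = code_of r.
  by rewrite /P -encE => /eqP/succn_inj/enc_inj.
exists (search P (fun r _ _ => r)); split; first split.
- apply: search_computable; last by computable_auto.
  by rewrite /P; computable_auto.
- move=> x p q.
  case E : (search _ _ p x) => [y|] // _; case F : (search _ _ q x) => [z|] // _.
  have [r /PE -> _] := search_Some E; have [s /PE -> _] := search_Some F.
  move=> /prefixP[u]; rewrite /code_of => Eu.
  have [rs|sr|->//] := ltngtP r s.
    have := congr1 (fun l => nth false l r) Eu.
    by rewrite nth_cat !nth_rcons !size_rcons !size_nseq nth_nseq rs ltnn eqxx ltnS leqnn.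
  by have := congr1 size Eu; rewrite size_cat !size_rcons !size_nseq; lia.
- move=> x y; exists (code_of (enc y)).
  rewrite (@searchE _ _ _ _ (enc y)) ?encK // /P encE //.
  move=> m /eqP E; apply/eqP; rewrite -(eqn_exp2l _ _ (isT : 1 < 2)).
  by rewrite -(eqn_pmul2l (isT : 0 < 3)) E.
Qed.

(** * Optimal machines *)

Local Close Scope nat_scope.

Section Asymptotics.
Variable R : realType.

Lemma e_approx_le1 U x y n : e_approx U x y n <= 1 :> R.
Proof.
rewrite e_approxE -[leRHS](avg_cst n 1); apply: avg_le => s _.
by rewrite lern1 leq_b1.
Qed.

Lemma e_approx_has_sup U x y : has_sup (range (@e_approx R U x y)).
Proof.
split; first by exists (e_approx U x y 0%N); exists 0%N.
by exists 1 => _ [n _ <-]; exact: e_approx_le1.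
Qed.

Lemma e_approx_le_eU U x y n : e_approx U x y n <= eU U x y :> R.
Proof. by apply: ub_le_sup; [have [] := e_approx_has_sup U x y|exists n]. Qed.

Lemma eU_le1 U x y : eU U x y <= 1 :> R.
Proof.
by apply: ge_sup; [have [] := e_approx_has_sup U x y|move=> _ [n _ <-]; exact: e_approx_le1].
Qed.

Lemma e_approx_gt U x y (a : R) : a < eU U x y -> exists n, a < e_approx U x y n.
Proof.
move=> aU; have [_ [n _ <-] lt] := sup_gt (proj1 (e_approx_has_sup U x y)) aU.
by exists n.
Qed.

Lemma eUC U x y : eU U x y = eU U y x :> R.
Proof.
rewrite /eU (_ : e_approx U x y = e_approx U y x) //; apply/funext => n.
by rewrite !e_approxE; apply: eq_avg => s _; rewrite andbC.
Qed.

Lemma ln2_gt0 : 0 < ln 2 :> R.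
Proof. by rewrite ln_gt0 // ltr1n. Qed.

Lemma ler_log2 (a b : R) : 0 < a -> a <= b -> log2 a <= log2 b.
Proof.
move=> a0 ab; rewrite /log2 ler_pM2r ?invr_gt0 ?ln2_gt0 //.
by rewrite ler_ln // posrE // (lt_le_trans a0).
Qed.

Lemma log2M (a b : R) : 0 < a -> 0 < b -> log2 (a * b) = log2 a + log2 b.
Proof. by move=> a0 b0; rewrite /log2 lnM ?posrE // mulrDl. Qed.

Lemma log2_weight n : log2 (weight R n) = - n%:R.
Proof.
rewrite /log2 /weight lnXn ?invr_gt0 // lnV ?posrE // -[_ *+ n]mulr_natl.
by rewrite mulrN mulNr -mulrA mulfV ?mulr1 // gt_eqF ?ln2_gt0.
Qed.

Lemma weight_between (e : R) : 0 < e -> e <= 1 ->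
  exists2 n, weight R n < e & n%:R <= 1 - log2 e.
Proof.
move=> e0 e1.
have l0 : 0 <= - log2 e.
  have := ler_log2 e0 e1; rewrite [log2 1](log2_weight 0) /=; lra.
have [lo hi] := andP (truncn_itv l0).
exists (Num.truncn (- log2 e)).+1%N; last by rewrite -natr1; lra.
rewrite ltNge; apply/negP => /(ler_log2 e0); rewrite log2_weight; lra.
Qed.

Lemma KPV_le (W : pfun2) p x y : W p x = Some y -> (KPV W y x <= ((size p)%:R : R)%:E)%E.
Proof. by move=> Wp; apply: ereal_inf_lbound; exists p. Qed.

Lemma KPV_attained (W : pfun2) x y : (exists p, W p x = Some y) ->
  exists2 p, W p x = Some y & KPV W y x = ((size p)%:R : R)%:E.
Proof.
move=> [p0 Wp0].
have ex : exists n, `[< exists2 p, W p x = Some y & size p = n >].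
  by exists (size p0); apply/asboolP; exists p0.
case: (ex_minnP ex) => n /asboolP[p Wp sp] nmin; exists p => //.
apply/eqP; rewrite eq_le KPV_le //=; apply: le_ereal_inf_tmp => _ [q Wq <-].
by rewrite lee_fin ler_nat sp; apply: nmin; apply/asboolP; exists q.
Qed.

(** Without a program the infimum over the empty set is [+oo], but optimality bounds it by the
    finite complexity for [unary_machine] plus a constant. *)
Lemma KP_optimal_total (V : pfun2) : @KP_optimal R V -> forall x y, exists p, V p x = Some y.
Proof.
move=> [_ optV] x y; have [W [pfW totW]] := unary_machine.
have [c Hc] := optV _ pfW; have [p Wp] := totW x y.
apply: contrapT => none; have := Hc x y.
have : (+oo <= KPV V y x :> \bar R)%E.
  by apply: le_ereal_inf_tmp => z [q Vq _]; case: none; exists q.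
move=> /le_trans H /H {H}.
by have := KPV_le Wp; case: (KPV W y x).
Qed.

End Asymptotics.

(* -log e(x,y) = max(KP(x|y), KP(y|x)) + O(1), for any optimal U (for e)
   and any optimal V (for KP). *)
Theorem theorem3 (R : realType) (U V : pfun2) :
  @e_optimal R U -> @KP_optimal R V ->
  exists c : R, forall x y : bstr,
    ((- log2 (@eU R U x y))%:E <= maxe (@KPV R V x y) (@KPV R V y x) + c%:E)%E /\
    (maxe (@KPV R V x y) (@KPV R V y x) <= (- log2 (@eU R U x y))%:E + c%:E)%E.
Proof.
move=> [pfU optU] optV; have [pfV minV] := optV.
have totV := KP_optimal_total optV.
have [U' [pfU' lowU']] := link_machine R pfV.
have [c1 [c10 Hc1]] := optU _ pfU'.
have [V' [pfV' codeV']] := coding_theorem R pfU.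
have [c2 Hc2] := minV _ pfV'.
have low x y p q : V p x = Some y -> V q y = Some x ->
    weight R (maxn (size p) (size q) + 5) <= c1 * eU U x y.
  move=> Vp Vq; have [m Hm] := lowU' _ _ _ _ Vp Vq.
  apply: le_trans Hm _; apply: le_trans (Hc1 x y); exact: e_approx_le_eU.
(* Positivity makes the logarithm meaningful, as [ln] takes a default value at nonpositive reals. *)
have e_gt0 x y : 0 < eU U x y :> R.
  have [p Vp] := totV x y; have [q Vq] := totV y x.
  by rewrite -(pmulr_rgt0 _ c10); apply: lt_le_trans (low _ _ _ _ Vp Vq); exact: weight_gt0.
have upper x y : (KPV V y x <= (- log2 (eU U x y : R))%:E + (4 + c2)%:E)%E.
  (* Some finite level exceeds half of the supremum. The halving costs 1, rounding the exponent 1,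
     and the coding theorem 2, hence the constant 4. *)
  have half_gt0 : 0 < eU U x y / 2 :> R by rewrite divr_gt0.
  have half_le1 : eU U x y / 2 <= 1 :> R by have := eU_le1 R U x y; lra.
  have [n wn nle] := weight_between half_gt0 half_le1.
  have [m Hm] : exists m, eU U x y / 2 < e_approx U x y m :> R.
    by apply: e_approx_gt; have := e_gt0 x y; lra.
  have [q sq V'q] := codeV' x y m n (ltW (lt_trans wn Hm)).
  apply: le_trans (Hc2 x y) _; apply: le_trans (leeD2r _ (KPV_le R V'q)) _.
  rewrite -!EFinD lee_fin sq natrD; move: nle.
  have -> : eU U x y / 2 = eU U x y * weight R 1 by rewrite /weight expr1.
  by rewrite log2M ?weight_gt0 // log2_weight; lra.
(* The 5 is the loss of the block machine, and [c1] the factor in the optimality of [U]; [4 + c2]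
   comes from [upper]. *)
exists (Num.max (5 + log2 c1) (4 + c2)) => x y.
have [p Vp Ep] := KPV_attained R (totV x y).
have [q Vq Eq] := KPV_attained R (totV y x).
have maxE : maxe (KPV V x y) (KPV V y x) = ((maxn (size p) (size q))%:R : R)%:E.
  rewrite Ep Eq -EFin_max; congr _%:E.
  have [le|/ltnW le] := leqP (size p) (size q).
    by apply/max_idPl; rewrite ler_nat.
  by apply/max_idPr; rewrite ler_nat.
split.
  rewrite maxE -EFinD lee_fin.
  have := ler_log2 (weight_gt0 R _) (low _ _ _ _ Vp Vq).
  rewrite log2M // log2_weight natrD => H.
  have : 5 + log2 c1 <= Num.max (5 + log2 c1) (4 + c2) by rewrite le_max lexx.
  lra.
have cle : 4 + c2 <= Num.max (5 + log2 c1) (4 + c2) by rewrite le_max lexx orbT.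
rewrite ge_max; apply/andP; split.
  by rewrite eUC; apply: le_trans (upper y x) _; rewrite leeD2l // lee_fin.
by apply: le_trans (upper x y) _; rewrite leeD2l // lee_fin.
Qed.
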